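(* There is an algorithm that, given an instance of Weighted Gerrymandering (W-GM) on an arbitrary graph together with a tie-breaking rule $\eta$, decides the instance (under $\eta$) in time $2^n (n+m)^{\mathcal{O}(1)}$, where $n=|V(G)|$ and $m=|\mathcal{C}|$.
   Context: Weighted Gerrymandering (W-GM): the input is a graph $G$ on $n$ vertices (voters), a set $\mathcal{C}$ of $m$ candidates, for each voter $v\in V(G)$ a weight function $w_v\colon\mathcal{C}\to\mathbb{Z}^+$, a distinguished candidate $p\in\mathcal{C}$, and a positive integer $k$. A district is a nonempty set $U\subseteq V(G)$ with $G[U]$ connected. A tie-breaking rule $\eta$ assigns to every district $U$ a single candidate $\eta(U)\in\arg\max_{q\in\mathcal{C}}\sum_{v\in U} w_v(q)$, called the winner of $U$. The question is whether $V(G)$ can be partitioned into $k$ pairwise disjoint districts such that $p$ wins strictly more of these districts than any other candidate. *)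

(* Defs.v *)
From HB Require Import structures.
From mathcomp Require Import all_boot.

Set Implicit Arguments.
Unset Strict Implicit.
Unset Printing Implicit Defensive.

(** * Weighted Gerrymandering *)

Record wgm (V C : finType) := WGM {
  adj : rel V;
  adj_sym : symmetric adj;
  adj_irrefl : irreflexive adj;
  weight : V -> C -> nat;
  weight_gt0 : forall v q, 0 < weight v q;
  target : C;
  nb_districts : nat;
  nb_districts_gt0 : 0 < nb_districts
}.

Section Problem.
Variables (V C : finType) (I : wgm V C).

Definition induced (U : {set V}) : rel V :=
  [rel x y | [&& x \in U, y \in U & adj I x y]].

Definition district (U : {set V}) : bool :=
  (U != set0) && [forall x in U, forall y in U, connect (induced U) x y].

Definition score (U : {set V}) (q : C) : nat := \sum_(v in U) weight I v q.

(** A tie-breaking rule is a total function on vertex sets, of which only the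
    values on districts are constrained. *)
Definition tie_breaking (eta : {set V} -> C) : Prop :=
  forall U, district U -> forall q, score U q <= score U (eta U).

Definition wins (eta : {set V} -> C) (P : {set {set V}}) (q : C) : nat :=
  #|[set U in P | eta U == q]|.

Definition wgm_yes (eta : {set V} -> C) : bool :=
  [exists P : {set {set V}},
    [&& partition P [set: V],
        #|P| == nb_districts I,
        [forall U in P, district U] &
        [forall (q | q != target I), wins eta P q < wins eta P (target I)]]].

End Problem.

(** * Word RAM with an oracle

    Structured programs on a machine with [w]-bit words, word-valued registers
    and a word-addressed memory.  Arithmetic is modulo [2 ^ w].  One time unit
    is charged for every expression node, assignment, store, oracle query and
    branch. *)

Inductive binop := OpAdd | OpSub | OpMul | OpDiv | OpMod | OpEq | OpLt.

Inductive expr :=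
  | Const of nat
  | Reg of nat
  | Fetch of expr
  | Bin of binop & expr & expr.

Inductive cmd :=
  | Skip
  | Assign of nat & expr
  | Store of expr & expr
  | Query of nat & expr
  | Seq of cmd & cmd
  | If of expr & cmd & cmd
  | While of expr & cmd.

Record state := State { reg : nat -> nat; mem : nat -> nat }.

Definition upd (f : nat -> nat) (i x : nat) : nat -> nat :=
  fun j => if j == i then x else f j.

Definition set_reg (s : state) (r x : nat) : state :=
  State (upd (reg s) r x) (mem s).

Definition set_mem (s : state) (a x : nat) : state :=
  State (reg s) (upd (mem s) a x).

(** Division by zero follows [divn] and [modn]: [x %/ 0 = 0], [x %% 0 = x]. *)
Definition eval_binop (w : nat) (o : binop) (x y : nat) : nat :=
  match o with
  | OpAdd => (x + y) %% 2 ^ w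
  | OpSub => (x + (2 ^ w - y)) %% 2 ^ w
  | OpMul => (x * y) %% 2 ^ w
  | OpDiv => x %/ y
  | OpMod => x %% y
  | OpEq => x == y
  | OpLt => x < y
  end.

Fixpoint eval (w : nat) (s : state) (e : expr) : nat :=
  match e with
  | Const x => x %% 2 ^ w
  | Reg r => reg s r
  | Fetch e1 => mem s (eval w s e1)
  | Bin o e1 e2 => eval_binop w o (eval w s e1) (eval w s e2)
  end.

Fixpoint expr_cost (e : expr) : nat :=
  match e with
  | Const _ | Reg _ => 1
  | Fetch e1 => (expr_cost e1).+1
  | Bin _ e1 e2 => (expr_cost e1 + expr_cost e2).+1
  end.

(** [exec w o c s t s'] : with word length [w] and oracle [o], the program [c]
    started in [s] halts in [s'] after [t] time units. *)
Inductive exec (w : nat) (o : nat -> nat) :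
    cmd -> state -> nat -> state -> Prop :=
  | ExecSkip s : exec w o Skip s 1 s
  | ExecAssign s r e :
      exec w o (Assign r e) s (expr_cost e).+1 (set_reg s r (eval w s e))
  | ExecStore s e1 e2 :
      exec w o (Store e1 e2) s (expr_cost e1 + expr_cost e2).+1
        (set_mem s (eval w s e1) (eval w s e2))
  | ExecQuery s r e :
      exec w o (Query r e) s (expr_cost e).+1 (set_reg s r (o (eval w s e)))
  | ExecSeq s1 s2 s3 c1 c2 t1 t2 :
      exec w o c1 s1 t1 s2 -> exec w o c2 s2 t2 s3 ->
      exec w o (Seq c1 c2) s1 (t1 + t2) s3
  | ExecIfTrue s s' e c1 c2 t :
      eval w s e != 0 -> exec w o c1 s t s' ->
      exec w o (If e c1 c2) s (expr_cost e + t).+1 s'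
  | ExecIfFalse s s' e c1 c2 t :
      eval w s e = 0 -> exec w o c2 s t s' ->
      exec w o (If e c1 c2) s (expr_cost e + t).+1 s'
  | ExecWhileTrue s1 s2 s3 e c t1 t2 :
      eval w s1 e != 0 -> exec w o c s1 t1 s2 ->
      exec w o (While e c) s2 t2 s3 ->
      exec w o (While e c) s1 (expr_cost e + t1 + t2).+1 s3
  | ExecWhileFalse s e c :
      eval w s e = 0 -> exec w o (While e c) s (expr_cost e).+1 s.

(** * Instances as machine inputs *)

(** Words need only have [c * (n + log2 (n + m)) + O(1)] bits, i.e. logarithmic in the
    running time. *)
Definition long_words (w a c n m : nat) : bool :=
  a * (2 ^ n * (n + m)) ^ c <= 2 ^ w.

Section Encoding.
Variables (n m : nat).

(** Four header words, then the adjacency matrix and the weight matrix, both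
    in row-major order. *)
Definition input_words (I : wgm 'I_n 'I_m) : seq nat :=
  [:: n; m; val (target I); nb_districts I]
  ++ [seq nat_of_bool (adj I u v) | u <- enum 'I_n, v <- enum 'I_n]
  ++ [seq weight I v q | v <- enum 'I_n, q <- enum 'I_m].

Definition init_state (I : wgm 'I_n 'I_m) : state :=
  State (fun=> 0) (nth 0 (input_words I)).

(** The vertex set whose characteristic bit vector is the word [x], vertex [v]
    being the bit of weight [2 ^ v]. *)
Definition set_of_word (x : nat) : {set 'I_n} :=
  [set v : 'I_n | odd (x %/ 2 ^ v)].

Definition rule_oracle (eta : {set 'I_n} -> 'I_m) (x : nat) : nat :=
  val (eta (set_of_word x)).

Definition fits (w : nat) (I : wgm 'I_n 'I_m) : bool :=
  all (fun x => x < 2 ^ w) (input_words I).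

(** The answer is the final content of register 0: 1 for yes, 0 for no. *)
Definition decides_within (w : nat) (prog : cmd) (I : wgm 'I_n 'I_m)
    (eta : {set 'I_n} -> 'I_m) (T : nat) : Prop :=
  exists (t : nat) (s : state),
    [/\ exec w (rule_oracle eta) prog (init_state I) t s,
        t <= T &
        reg s 0 = nat_of_bool (wgm_yes I eta)].

End Encoding.

(* Main.v *)
Require Import Defs.
From mathcomp Require Import all_boot.
From mathcomp Require Import zify.

Set Implicit Arguments.
Unset Strict Implicit.
Unset Printing Implicit Defensive.

(** The algorithm never reads the weights: the oracle tells who wins a district.
    A family of nonempty sets covering [n] vertices with total size [n] is a
    partition, so disjointness can be traded for a count of the total size.
    The solution sought covers [V] with total size [n], consists of exactly [k]
    districts, and for some [t < n] has [t + 1] districts won by the target and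
    at most [t] by every other candidate.  For each [t] the districts are chosen
    one slot at a time.  The table of all pairs (union, weight) reached so far,
    the weight encoding total size and number of districts, is updated by a
    product that is polynomial in the weight and a union product on sets.  Such
    a product is pointwise after a zeta transform, computed in [n 2^n] steps by
    Yates's algorithm.  The Moebius transform brings it back, and the counts are
    clipped to 0 or 1 before the next slot, so that all intermediate values stay
    within [(n+1)^2 4^n] and fit in a word; run stage by stage, the Moebius
    transform only meets partial zeta transforms of a nonnegative function, so
    no negative number occurs. *)

(** * A language of bounded loops *)

Inductive stmt :=
  | Asg of nat & expr
  | Sto of expr & expr
  | Qry of nat & expr
  | Sq of stmt & stmt
  | Cnd of expr & stmt
  | For of nat & nat & stmt.

Definition incr r := Bin OpAdd (Reg r) (Const 1).

Fixpoint compile (c : stmt) : cmd :=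
  match c with
  | Asg r e => Assign r e
  | Sto e1 e2 => Store e1 e2
  | Qry r e => Query r e
  | Sq c1 c2 => Seq (compile c1) (compile c2)
  | Cnd e c1 => If e (compile c1) Skip
  | For r b c1 =>
      Seq (Assign r (Const 0))
          (While (Bin OpLt (Reg r) (Reg b)) (Seq (compile c1) (Assign r (incr r))))
  end.

Fixpoint mods (c : stmt) : seq nat :=
  match c with
  | Asg r _ | Qry r _ => [:: r]
  | Sto _ _ => [::]
  | Sq c1 c2 => mods c1 ++ mods c2
  | Cnd _ c1 => mods c1
  | For r _ c1 => r :: mods c1
  end.

(* Bounds and counters are not overwritten, so the number of rounds of each loop
   is known on entry: this makes [run] total and time bounds compositional. *)
Fixpoint ok (bd : seq nat) (c : stmt) : bool :=
  match c with
  | Asg r _ | Qry r _ => r \notin bd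
  | Sto _ _ => true
  | Sq c1 c2 => ok bd c1 && ok bd c2
  | Cnd _ c1 => ok bd c1
  | For r b c1 => [&& r \notin bd, b \in bd, r \notin mods c1 & ok bd c1]
  end.

Section Run.
Variables (w : nat) (o : nat -> nat).

Fixpoint run (c : stmt) (s : state) : state :=
  match c with
  | Asg r e => set_reg s r (eval w s e)
  | Sto e1 e2 => set_mem s (eval w s e1) (eval w s e2)
  | Qry r e => set_reg s r (o (eval w s e))
  | Sq c1 c2 => run c2 (run c1 s)
  | Cnd e c1 => if eval w s e != 0 then run c1 s else s
  | For r b c1 =>
      iter (reg s b) (fun s1 => let s2 := run c1 s1 in set_reg s2 r (eval w s2 (incr r)))
           (set_reg s r (eval w s (Const 0)))
  end.

Lemma run_frame c s x : x \notin mods c -> reg (run c s) x = reg s x.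
Proof.
elim: c s => [r e|e1 e2|r e|c1 IH1 c2 IH2|e c IH|r b c IH] s //=.
- by rewrite inE /upd => /negbTE ->.
- by rewrite inE /upd => /negbTE ->.
- by rewrite mem_cat negb_or => /andP[h1 h2]; rewrite IH2 // IH1.
- by move=> h; case: ifP => // _; exact: IH.
rewrite inE negb_or => /andP[/negbTE h1 h2].
elim: (reg s b) => [|k IHk] /=; first by rewrite /upd h1.
by rewrite /upd h1 IH.
Qed.

Lemma ok_mods bd c b : ok bd c -> b \in bd -> b \notin mods c.
Proof.
move=> + bin; elim: c => [r e|e1 e2|r e|c1 IH1 c2 IH2|e c IH|r b' c IH] //=.
- by rewrite inE; apply: contra => /eqP <-.
- by rewrite inE; apply: contra => /eqP <-.
- by rewrite mem_cat negb_or => /andP[/IH1 -> /IH2 ->].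
case/and4P=> h1 _ _ /IH h2; rewrite inE negb_or h2 andbT.
by apply: contraNneq h1 => <-.
Qed.

Definition round r c s i :=
  iter i (fun s1 => let s2 := run c s1 in set_reg s2 r (eval w s2 (incr r)))
    (set_reg s r (eval w s (Const 0))).

Lemma round_reg r c s i : i < 2 ^ w -> r \notin mods c -> reg (round r c s i) r = i.
Proof.
move=> iw rc; elim: i iw => [|i IH] iw /=; rewrite /upd eqxx ?mod0n //.
rewrite run_frame // IH; last exact: ltnW.
rewrite modnDmr addn1 modn_small //.
Qed.

Lemma round_frame r c s i x :
  x != r -> x \notin mods c -> reg (round r c s i) x = reg s x.
Proof.
move=> /negbTE xr xc; elim: i => [|i IH] /=; rewrite /upd xr //.
by rewrite run_frame.
Qed.

Lemma run_for (Inv : nat -> state -> Prop) r b c s :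
    reg s b < 2 ^ w -> r \notin mods c ->
    Inv 0 (set_reg s r 0) ->
    (forall i s', i < reg s b -> reg s' r = i ->
       (forall x, x != r -> x \notin mods c -> reg s' x = reg s x) ->
       Inv i s' -> Inv i.+1 (set_reg (run c s') r i.+1)) ->
  Inv (reg s b) (run (For r b c) s).
Proof.
move=> bw rc I0 IS; rewrite /= -/(round r c s (reg s b)).
suff: forall i, i <= reg s b -> Inv i (round r c s i) by apply.
elim=> [|i IH] ib; first by rewrite /= mod0n.
rewrite /= -/(round r c s i).
have iw : i < 2 ^ w by apply: ltn_trans bw.
have -> : reg (run c (round r c s i)) r + 1 %% 2 ^ w = reg (round r c s i.+1) r %[mod 2 ^ w].
  by rewrite /= /upd eqxx !modn_mod.
rewrite round_reg ?modn_small //; try exact: leq_ltn_trans bw.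
apply: IS => //; [exact: round_reg| |exact/IH/ltnW].
by move=> x; exact: round_frame.
Qed.

End Run.

Fixpoint coef (c : stmt) : nat :=
  match c with
  | Asg _ e | Qry _ e => (expr_cost e).+1
  | Sto e1 e2 => (expr_cost e1 + expr_cost e2).+1
  | Sq c1 c2 => coef c1 + coef c2
  | Cnd e c1 => (expr_cost e + coef c1).+2
  | For _ _ c1 => coef c1 + 16
  end.

Fixpoint dega (dg : nat -> nat * nat) (c : stmt) : nat * nat :=
  match c with
  | Asg _ _ | Qry _ _ | Sto _ _ => (0, 0)
  | Sq c1 c2 => (maxn (dega dg c1).1 (dega dg c2).1, maxn (dega dg c1).2 (dega dg c2).2)
  | Cnd _ c1 => dega dg c1
  | For _ b c1 => ((dg b).1 + (dega dg c1).1, (dg b).2 + (dega dg c1).2)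
  end.

Section Cost.
Variables (w : nat) (o : nat -> nat) (x y : nat) (dg : nat -> nat * nat).
Hypotheses (x_gt0 : 0 < x) (y_gt0 : 0 < y).

Definition monom (d : nat * nat) := x ^ d.1 * y ^ d.2.

Lemma monom_gt0 d : 0 < monom d.
Proof. by rewrite muln_gt0 !expn_gt0 x_gt0 y_gt0. Qed.

Lemma monom_le d d' : d.1 <= d'.1 -> d.2 <= d'.2 -> monom d <= monom d'.
Proof. by move=> h1 h2; rewrite leq_mul ?leq_pexp2l. Qed.

Definition bounded (bd : seq nat) s :=
  forall b, b \in bd -> reg s b < 2 ^ w /\ reg s b <= monom (dg b).

Lemma compile_exec bd c s : ok bd c -> bounded bd s ->
  exists2 t, exec w o (compile c) s t (run w o c s) & t <= coef c * monom (dega dg c).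
Proof.
have one k : k <= k * monom (0, 0) by rewrite leq_pmulr // monom_gt0.
elim: c s => [r e|e1 e2|r e|c1 IH1 c2 IH2|e c IH|r b c IH] s.
- by move=> _ _; exists (expr_cost e).+1 => //; constructor.
- by move=> _ _; exists (expr_cost e1 + expr_cost e2).+1 => //; constructor.
- by move=> _ _; exists (expr_cost e).+1 => //; constructor.
- move=> /= /andP[ok1 ok2] bs; have [t1 ex1 le1] := IH1 _ ok1 bs.
  have bs1 : bounded bd (run w o c1 s).
    by move=> b bb; rewrite run_frame ?(ok_mods ok1) //; exact: bs.
  have [t2 ex2 le2] := IH2 _ ok2 bs1; exists (t1 + t2); first by econstructor; eauto.
  rewrite mulnDl leq_add //; [apply: leq_trans le1 _|apply: leq_trans le2 _];
    by rewrite leq_mul2l monom_le ?orbT //= ?leq_maxl ?leq_maxr.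
- move=> /= okc bs; have [t ex le] := IH _ okc bs.
  case: ifP => h; [exists (expr_cost e + t).+1|exists (expr_cost e + 1).+1].
  + exact: ExecIfTrue.
  + by have := monom_gt0 (dega dg c); nia.
  + by apply: ExecIfFalse; [exact/eqP/negbFE|exact: ExecSkip].
  + by have := monom_gt0 (dega dg c); nia.
move=> /= /and4P[rbd bbd rc okc] bs; have [bw ble] := bs _ bbd.
have rb : b != r by apply: contraNneq rbd => <-.
have bc := ok_mods okc bbd.
pose T := coef c * monom (dega dg c) + 10.
have loop j : j <= reg s b -> exists2 t,
  exec w o (While (Bin OpLt (Reg r) (Reg b)) (Seq (compile c) (Assign r (incr r))))
    (round w o r c s (reg s b - j)) t (round w o r c s (reg s b)) & t <= j * T + 4.
  elim: j => [_|j IHj lj].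
    exists 4 => //; rewrite subn0; apply: ExecWhileFalse => /=.
    by rewrite round_reg // round_frame // ltnn.
  have [t2 ex2 le2] := IHj (ltnW lj); set i := reg s b - j.+1 in ex2 *.
  have ei : reg s b - j = i.+1 by rewrite /i; lia.
  have bi : bounded bd (round w o r c s i).
    move=> b' bb'; rewrite round_frame ?(ok_mods okc) //; first exact: bs.
    by apply: contraNneq rbd => <-.
  have [t1 ex1 le1] := IH _ okc bi.
  exists (3 + (t1 + 4) + t2).+1; last by rewrite /T in le2 *; lia.
  apply: (ExecWhileTrue (e := Bin OpLt (Reg r) (Reg b)) (s2 := round w o r c s i.+1)).
  + have iw : i < 2 ^ w by rewrite /i; lia.
    by rewrite /= round_reg // round_frame //; rewrite /i; lia.
  + by apply: ExecSeq ex1 _; exact: (@ExecAssign _ _ _ _ (incr r)).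
  + by rewrite -ei.
have [t ext let_] := loop _ (leqnn _); rewrite subnn in ext.
exists (2 + t); first by apply: ExecSeq ext; exact: (@ExecAssign _ _ _ _ (Const 0)).
have mE : monom ((dg b).1 + (dega dg c).1, (dg b).2 + (dega dg c).2) =
          monom (dg b) * monom (dega dg c) by rewrite /monom /= !expnD; lia.
rewrite mE; have := monom_gt0 (dega dg c); have := monom_gt0 (dg b).
move: let_ ble; rewrite /T; set A := monom (dg b); set D := monom (dega dg c).
move: (reg s b) (coef c) => q K; clear; clearbody A D => h1 h2 h3 h4.
have h5 := leq_mul h2 (leqnn (K * D + 10)).
have h6 : A <= A * D by rewrite leq_pmulr.
rewrite [_ * (A * D)]mulnDl mulnCA; lia.
Qed.

End Cost.

(** * Vertex sets as words, zeta transform, connected sets *)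

Section Words.
Variable n : nat.
Implicit Types (U W A B : {set 'I_n}) (v : 'I_n).

Definition word U := \sum_(v in U) 2 ^ v.

Lemma sum_bits k x : \sum_(i < k) odd (x %/ 2 ^ i) * 2 ^ i = x %% 2 ^ k.
Proof.
elim: k => [|k IH]; first by rewrite big_ord0 modn1.
rewrite big_ord_recr /= IH; set r := x %% _; set q := x %/ _.
have xE : x = q./2 * 2 ^ k.+1 + (r + odd q * 2 ^ k).
  by rewrite (divn_eq x (2 ^ k)) -/r -/q -{1}(odd_double_half q) expnS; lia.
rewrite [in RHS]xE modnMDl modn_small //.
have : r < 2 ^ k by rewrite ltn_mod expn_gt0.
by rewrite expnS; case: odd; lia.
Qed.

Lemma word_set x : word (set_of_word n x) = x %% 2 ^ n.
Proof.
rewrite -sum_bits /word big_mkcond /=; apply: eq_bigr => v _.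
by rewrite inE; case: odd; lia.
Qed.

Lemma set_word_bij U : exists2 x, x < 2 ^ n & U = set_of_word n x.
Proof.
pose f (x : 'I_(2 ^ n)) := set_of_word n x.
have f_inj : injective f.
  move=> x y /(congr1 word); rewrite !word_set !modn_small // => xy.
  exact: val_inj.
have : U \in codom f.
  apply: (inj_card_onto f_inj).
  by rewrite card_ord -cardsT -powersetT card_powerset cardsT card_ord.
by case/codomP=> x ->; exists (val x); first exact: ltn_ord.
Qed.

Lemma set_word U : set_of_word n (word U) = U.
Proof. by have [x xn ->] := set_word_bij U; rewrite word_set modn_small. Qed.

Lemma word_lt U : word U < 2 ^ n.
Proof. by rewrite -(set_word U) word_set ltn_mod expn_gt0. Qed.

Lemma word_D1 U v : v \in U -> word U = 2 ^ v + word (U :\ v).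
Proof. by move=> vU; rewrite /word (big_setD1 v). Qed.

Lemma word0 : word set0 = 0.
Proof. by rewrite /word big_set0. Qed.

Lemma wordT : word setT = (2 ^ n).-1.
Proof.
have := word_set (2 ^ n).-1; rewrite modn_small; last by rewrite ltn_predL expn_gt0.
suff -> : set_of_word n (2 ^ n).-1 = setT by [].
apply/setP=> v; rewrite !inE.
have -> : 2 ^ n = 2 ^ (n - v) * 2 ^ v by rewrite -expnD subnK // ltnW.
have vn : 0 < n - v by rewrite subn_gt0.
have -> : (2 ^ (n - v) * 2 ^ v).-1 = (2 ^ (n - v)).-1 * 2 ^ v + (2 ^ v).-1.
  by have := expn_gt0 2 (n - v); have := expn_gt0 2 v; nia.
rewrite divnMDl ?expn_gt0 // divn_small ?addn0 ?ltn_predL ?expn_gt0 //.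
by rewrite -subn1 oddB ?expn_gt0 // oddX eqn0Ngt vn.
Qed.

(* A table index packs a degree and a vertex set into one number. *)
Definition idx g U := g * 2 ^ n + word U.
Definition deg y := y %/ 2 ^ n.
Definition vset y := set_of_word n y.

Lemma deg_idx g U : deg (idx g U) = g.
Proof. by rewrite /deg /idx divnMDl ?expn_gt0 // divn_small ?addn0 // word_lt. Qed.

Lemma vset_mod y : vset (y %% 2 ^ n) = vset y.
Proof. by rewrite -[LHS]set_word word_set modn_mod -word_set set_word. Qed.

Lemma vset_idx g U : vset (idx g U) = U.
Proof. by rewrite -vset_mod /idx modnMDl modn_small ?word_lt // /vset set_word. Qed.

Lemma idxE y : idx (deg y) (vset y) = y.
Proof. by rewrite /idx word_set [RHS](divn_eq y (2 ^ n)). Qed.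

Lemma idx_inj g U g' U' : (idx g U == idx g' U') = (g == g') && (U == U').
Proof.
apply/eqP/andP=> [E|[/eqP-> /eqP->] //].
by split; [rewrite -(deg_idx g U) E deg_idx|rewrite -(vset_idx g U) E vset_idx].
Qed.

Lemma idx_lt g h U : (idx g U < h * 2 ^ n) = (g < h).
Proof. by rewrite -ltn_divLR ?expn_gt0 // -/(deg _) deg_idx. Qed.

Lemma deg_lt y h : (deg y < h) = (y < h * 2 ^ n).
Proof. by rewrite ltn_divLR ?expn_gt0. Qed.

Lemma idx_D1 g U v : v \in U -> idx g U - 2 ^ v = idx g (U :\ v).
Proof. by move=> vU; rewrite /idx (word_D1 vU) addnCA addKn. Qed.

Lemma sub_pow y v : v \in vset y -> y - 2 ^ v = idx (deg y) (vset y :\ v).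
Proof. by move=> vy; rewrite -idx_D1 // idxE. Qed.

Lemma idx_sub g h U : h <= g -> idx g U - h * 2 ^ n = idx (g - h) U.
Proof. by move=> hg; rewrite /idx mulnBl; have := leq_mul hg (leqnn (2 ^ n)); lia. Qed.

Lemma bit_vset y v : (y %/ 2 ^ v) %% 2 = (v \in vset y).
Proof. by rewrite modn2 inE. Qed.

(* Stage [i] of Yates's algorithm. *)
Definition zeta (i : nat) (f : {set 'I_n} -> nat) U :=
  \sum_(W : {set 'I_n} | (W \subset U) && [forall v in U, (i <= v) ==> (v \in W)]) f W.

Lemma zeta0 f U : zeta 0 f U = f U.
Proof.
rewrite /zeta (big_pred1 U) // => W /=; rewrite eqEsubset; congr (_ && _).
by apply/forall_inP/subsetP => h v /h.
Qed.

Lemma zeta_full f U : zeta n f U = \sum_(W : {set 'I_n} | W \subset U) f W.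
Proof.
apply: eq_bigl => W; rewrite -[RHS]andbT; congr (_ && _).
by apply/forall_inP => v _; rewrite leqNgt ltn_ord.
Qed.

Lemma zetaS_notin f U v : v \notin U -> zeta v.+1 f U = zeta v f U.
Proof.
move=> vU; apply: eq_bigl => W; congr (_ && _).
apply: eq_forallb_in => u uU; rewrite [v <= u]leq_eqVlt.
by case: eqP => // /ord_inj vu; rewrite vu uU in vU.
Qed.

Lemma zetaS_in f U v : v \in U -> zeta v.+1 f U = zeta v f U + zeta v f (U :\ v).
Proof.
move=> vU; rewrite /zeta (bigID (fun W : {set 'I_n} => v \in W)) /=; congr (_ + _);
  apply: eq_bigl => W.
  rewrite -andbA; congr (_ && _); apply/andP/forall_inP => [[/forall_inP h vW] u uU|h].
    rewrite leq_eqVlt; case: eqP => [/ord_inj <- //|_ /=]; exact: h.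
  split; last by apply: (implyP (h v vU)).
  by apply/forall_inP => u uU; apply/implyP => /ltnW; apply/implyP/h.
rewrite subsetD1 -!andbA; congr (_ && _); rewrite andbC; case vW: (v \in W) => //=.
apply/forall_inP/forall_inP => h u.
  rewrite in_setD1 => /andP[uv uU]; rewrite leq_eqVlt.
  by case: eqP => [/ord_inj vu|_ /=]; [rewrite vu eqxx in uv|exact: h].
move=> uU; apply/implyP => vu; apply: (implyP (h u _)); last exact: ltnW.
by rewrite in_setD1 uU andbT; apply: contraTneq vu => ->; rewrite ltnn.
Qed.

Lemma zetaS f U v : zeta v.+1 f U = zeta v f U + (v \in U) * zeta v f (U :\ v).
Proof.
by case vU: (v \in U); [rewrite zetaS_in // mul1n|rewrite zetaS_notin ?vU // addn0].
Qed.

Lemma zetaS_D1 f U v : zeta v.+1 f (U :\ v) = zeta v f (U :\ v).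
Proof. by rewrite zetaS_notin // in_setD1 eqxx. Qed.

Lemma zeta_le f k i U : (forall W, f W <= k) -> zeta i f U <= 2 ^ n * k.
Proof.
move=> fk; apply: leq_trans (_ : \sum_(W : {set 'I_n}) k <= _).
  by rewrite /zeta big_mkcond leq_sum // => W _; case: ifP.
by rewrite sum_nat_const -cardsT -powersetT card_powerset cardsT card_ord.
Qed.

Lemma zeta_le_full i f U : zeta i f U <= zeta n f U.
Proof.
rewrite zeta_full /zeta [leqRHS]big_mkcond [leqLHS]big_mkcond leq_sum // => W _.
by case: (W \subset U) => //=; case: ifP.
Qed.

(* The product of two polynomials whose coefficients are set functions
   multiplied along unions. *)
Definition cover_prod (f b : nat -> {set 'I_n} -> nat) g U :=
  \sum_(h < g.+1) \sum_(A : {set 'I_n}) \sum_(B : {set 'I_n} | A :|: B == U)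
    f (g - h) A * b h B.

Lemma zeta_cover_prod f b g U :
  zeta n (cover_prod f b g) U = \sum_(h < g.+1) zeta n (f (g - h)) U * zeta n (b h) U.
Proof.
rewrite zeta_full /cover_prod exchange_big /=; apply: eq_bigr => h _.
rewrite !zeta_full exchange_big /= big_distrl /= [RHS]big_mkcond; apply: eq_bigr => A _.
rewrite (exchange_big_dep (fun B : {set 'I_n} => A :|: B \subset U)) /=; last first.
  by move=> W B WU /eqP ->.
case AU: (A \subset U); last by rewrite big1 // => B; rewrite subUset AU.
rewrite big_distrr /=; apply: eq_big => [B|B]; first by rewrite subUset AU.
move=> ABU; rewrite (big_pred1 (A :|: B)) // => W /=.
by rewrite eq_sym; case: eqP => [->|]; rewrite ?ABU ?andbF.
Qed.

Lemma cover_prod_gt0 (f b : nat -> {set 'I_n} -> bool) g U :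
  (0 < cover_prod f b g U) =
  [exists h : 'I_g.+1, exists A : {set 'I_n}, exists B : {set 'I_n},
     [&& A :|: B == U, f (g - h) A & b h B]].
Proof.
rewrite /cover_prod lt0n sum_nat_eq0 negb_forall; apply: eq_existsb => h.
rewrite implyTb sum_nat_eq0 negb_forall; apply: eq_existsb => A.
rewrite implyTb sum_nat_eq0 negb_forall; apply: eq_existsb => B.
by rewrite negb_imply muln_eq0 negb_or !eqb0 !negbK.
Qed.

End Words.

Section Partition.
Variables (n m : nat) (I : wgm 'I_n 'I_m) (eta : {set 'I_n} -> 'I_m).
Implicit Types (U W A B X : {set 'I_n}) (us : seq {set 'I_n}).

Lemma induced_sym U : connect_sym (induced I U).
Proof.
by apply: sym_connect_sym => x y; rewrite /induced /= (adj_sym I) andbCA.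
Qed.

Lemma districtP U :
  reflect (U != set0 /\ {in U &, forall x y, connect (induced I U) x y}) (district I U).
Proof.
apply: (iffP andP) => [[U0 /forall_inP h]|[U0 h]]; split=> //.
  by move=> x y xU yU; apply: (forall_inP (h x xU)).
by apply/forall_inP => x xU; apply/forall_inP => y yU; apply: h.
Qed.

Lemma district1 v : district I [set v].
Proof.
apply/districtP; split; first by apply/set0Pn; exists v; rewrite in_set1.
by move=> x y /set1P -> /set1P ->; exact: connect0.
Qed.

Lemma districtU1 W u v : district I W -> u \in W -> adj I u v -> district I (v |: W).
Proof.
move=> /districtP[W0 cW] uW uv; apply/districtP; split.
  by apply/set0Pn; exists v; rewrite setU11.
suff cu x : x \in v |: W -> connect (induced I (v |: W)) u x.
  by move=> x y xW yW; apply: connect_trans (cu y yW); rewrite induced_sym cu.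
case/setU1P => [->|xW].
  by apply: connect1; rewrite /induced /= setU11 setU1r.
apply: connect_sub (cW _ _ uW xW) => a b /and3P[aW bW ab].
by apply: connect1; rewrite /induced /= !setU1r.
Qed.

Lemma district_edge U W : district I U -> W \proper U -> W != set0 ->
  exists u v, [/\ u \in W, v \in U, v \notin W & adj I u v].
Proof.
move=> /districtP[_ cU] /properP[WU [y yU yW]] /set0Pn[x xW].
have [/existsP[u /existsP[v /and4P[? ? ? ?]]]|/existsPn noedge] :=
  boolP [exists u, exists v, [&& u \in W, v \in U, v \notin W & adj I u v]].
  by exists u, v.
have cl : closed (induced I U) (mem W).
  move=> a b /and3P[aU bU ab]; apply/idP/idP => h; apply: contraT => h'.
    by have /existsPn/(_ b) := noedge a; rewrite h bU h' ab.
  by have /existsPn/(_ a) := noedge b; rewrite h aU h' adj_sym ab.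
by have := closed_connect cl (cU x y (subsetP WU _ xW) yU); rewrite xW (negbTE yW).
Qed.

Lemma district_grow U :
  district I U = [exists v in U, (U == [set v]) ||
    district I (U :\ v) && [exists u in U, adj I u v]].
Proof.
apply/idP/exists_inP => [dU|[v vU /orP[/eqP ->|]]]; last first.
- case/andP => dW /exists_inP[u uU uv].
  rewrite -(setD1K vU); apply: (districtU1 dW _ uv).
  by rewrite in_setD1 uU andbT; apply: contraTneq uv => ->; rewrite adj_irrefl.
- exact: district1.
have /districtP[/set0Pn[x xU] _] := dU.
have [/eqP U1|U1] := boolP (U == [set x]); first by exists x; rewrite // U1 eqxx.
pose P W := district I W && (W \proper U).
have Px : P [set x].
  by rewrite /P district1 properEneq eq_sym U1 sub1set.
have [W /maxsetP[/andP[dW WU] maxW] _] := maxset_exists Px.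
have /districtP[W0 _] := dW.
have [u [v [uW vU vW uv]]] := district_edge dU WU W0.
have vWU : v |: W \subset U by rewrite subUset sub1set vU proper_sub.
have UE : U = v |: W.
  apply/eqP; rewrite eq_sym; apply: contraNT vW => neq.
  rewrite -(maxW (v |: W)) ?setU11 ?subsetUr // /P properEneq neq vWU.
  by rewrite (districtU1 dW uW uv).
exists v => //; apply/orP; right; rewrite UE setU1K // dW.
by apply/exists_inP; exists u; rewrite ?setU1r.
Qed.
End Partition.

(** * Slots and partitions *)

Section Slots.
Variables (n m : nat) (I : wgm 'I_n 'I_m) (eta : {set 'I_n} -> 'I_m).
Implicit Types (U W A B X : {set 'I_n}) (us : seq {set 'I_n}).

(* Both the size of a district and the number of districts are read off the
   total weight of a coverable: it is [(n + 1) * (total size) + (number)]. *)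
Definition wt U := (n.+1 * #|U|).+1.

Definition won_by (q h : nat) U : bool :=
  [&& district I U, eta U == q :> nat & h == wt U].

(* A slot [(q, b)] takes one district won by [q], or none if [b] holds.
    [coverable sl g U]: filling the slots [sl] can cover exactly [U] with total
    weight [g]. *)
Fixpoint coverable (sl : seq (nat * bool)) (g : nat) U : bool :=
  if sl is (q, b) :: sl1 then
    b && coverable sl1 g U ||
    [exists h : 'I_g.+1, exists A : {set 'I_n}, exists B : {set 'I_n},
       [&& A :|: B == U, coverable sl1 (g - h) A & won_by q h B]]
  else (g == 0) && (U == set0).

Fixpoint fills (sl : seq (nat * bool)) us : Prop :=
  if sl is (q, b) :: sl1 then
    (b /\ fills sl1 us) \/
    (exists U us1, [/\ us = U :: us1, district I U, eta U = q :> nat & fills sl1 us1])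
  else us = [::].

Lemma coverableP sl g U :
  coverable sl g U <->
  exists us, [/\ fills sl us, \bigcup_(X <- us) X = U & \sum_(X <- us) wt X = g].
Proof.
elim: sl g U => [|[q b] sl IH] g U /=.
  split=> [/andP[/eqP -> /eqP ->]|[us [-> <- <-]]]; last by rewrite !big_nil !eqxx.
  by exists [::]; rewrite !big_nil.
split=> [/orP[/andP[bT /IH[us [fus cov sz]]]|]|[us [[[bT fus]|[X [us1 [-> dX eX fus]]]]]]].
- by exists us; split=> //; left.
- case/existsP=> h /existsP[A /existsP[B /and3P[/eqP <- /IH[us [fus cov sz]]]]].
  case/and3P=> dB /eqP eB /eqP hB; exists (B :: us); rewrite !big_cons; split.
  + by right; exists B, us.
  + by rewrite cov setUC.
  + by rewrite sz -hB; have := ltn_ord h; lia.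
- by move=> cov sz; rewrite bT; apply/orP; left; apply/IH; exists us.
rewrite !big_cons => <- <-; apply/orP; right.
have hX : wt X < (wt X + \sum_(j <- us1) wt j).+1 by rewrite ltnS leq_addr.
apply/existsP; exists (Ordinal hX); apply/existsP; exists (\bigcup_(j <- us1) j).
apply/existsP; exists X; rewrite setUC eqxx /= /won_by dX eX !eqxx addKn !andbT.
by apply/IH; exists us1.
Qed.

Lemma fills_cat sl1 sl2 us1 us2 :
  fills sl1 us1 -> fills sl2 us2 -> fills (sl1 ++ sl2) (us1 ++ us2).
Proof.
elim: sl1 us1 => [|[q b] sl1 IH] us1 /=; first by move=> ->.
move=> [[bT f1]|[U [us [-> dU eU f1]]]] f2; [left|right]; first by split=> //; apply: IH.
by exists U, (us ++ us2); split=> //; apply: IH.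
Qed.

Lemma fills_nseq k q (b : bool) us :
    all (district I) us -> all (fun U => eta U == q :> nat) us ->
    size us <= k -> (~~ b -> size us = k) ->
  fills (nseq k (q, b)) us.
Proof.
elim: k us => [|k IH] [|U us] //=.
  move=> _ _ _; case: b IH => [IH _|_ /(_ isT)//]; left; split=> //; exact: IH.
case/andP=> dU dus /andP[/eqP eU eus] sz bsz; right; exists U, us; split=> //.
by apply: IH => // /bsz [].
Qed.

Lemma fills_district sl us : fills sl us -> all (district I) us.
Proof.
elim: sl us => [|[q b] sl IH] us /=; first by move=> ->.
by case=> [[_ /IH]|[U [us1 [-> /= -> _ /IH]]]].
Qed.

Lemma fills_count_le sl us q : fills sl us ->
  count (fun U => eta U == q :> nat) us <= count (fun x => x.1 == q) sl.
Proof.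
elim: sl us => [|[q1 b] sl IH] us /=; first by move=> ->.
case=> [[_ /IH]|[U [us1 [-> _ <- /IH]]]] /=; lia.
Qed.

Lemma fills_count_ge sl us q : fills sl us ->
  count (pred1 (q, false)) sl <= count (fun U => eta U == q :> nat) us.
Proof.
elim: sl us => [|[q1 b] sl IH] us /=; first by move=> ->.
rewrite xpair_eqE; case=> [[-> /IH]|[U [us1 [-> _ <- /IH]]]] /=; first by rewrite andbF.
case: (eta U == q :> nat); case: (b == false) => /=; lia.
Qed.

(* The target takes exactly [t + 1] districts and every other candidate at most [t]. *)
Fixpoint slots (p t j : nat) : seq (nat * bool) :=
  if j is j1.+1 then nseq (t + (j1 == p)) (j1, j1 != p) ++ slots p t j1 else [::].

Lemma count_slots p t j q :
  count (fun x => x.1 == q) (slots p t j) = if q < j then t + (q == p) else 0.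
Proof.
elim: j => [|j IH] //=; rewrite count_cat count_nseq IH /= ltnS (eq_sym j q).
by case: ltngtP => [_|_|->] /=; lia.
Qed.

Lemma count_target_slots p t j :
  count (pred1 (p, false)) (slots p t j) = if p < j then t.+1 else 0.
Proof.
elim: j => [|j IH] //=; rewrite count_cat count_nseq IH /= xpair_eqE ltnS (eq_sym j p).
by case: ltngtP => [_|_|_] /=; lia.
Qed.

Lemma uniq_disjoint_sum us : all (fun U => U != set0) us ->
    \sum_(X <- us) #|X| <= #|\bigcup_(X <- us) X| ->
  uniq us /\ trivIset [set X in us].
Proof.
move=> us0 le; have un : uniq us.
  elim: us us0 le => //= U us IH /andP[U0 us0]; rewrite !big_cons => le.
  have cU := cardsUI U (\bigcup_(j <- us) j).
  have le1 : #|\bigcup_(j <- us) j| <= \sum_(j <- us) #|j|.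
    elim: {U0 us0 le cU IH} us => [|X us IH]; first by rewrite !big_nil cards0.
    by rewrite !big_cons; have := cardsUI X (\bigcup_(j <- us) j); lia.
  rewrite IH ?us0 //; last by rewrite -(leq_add2l #|U|) (leq_trans le) // -cU leq_addr.
  rewrite andbT; apply/negP => Uus.
  have /setUidPr E : U \subset \bigcup_(j <- us) j by rewrite bigcup_seq (bigcup_sup U).
  move: le; rewrite E => /leq_trans/(_ le1).
  by rewrite -[leqRHS]add0n leq_add2r leqn0 cards_eq0 (negbTE U0).
split=> //; rewrite -(leq_card_cover _).2 eqn_leq (leq_card_cover _).1 /=.
have big_us (R : Type) (idx : R) (op : Monoid.com_law idx) (F : {set 'I_n} -> R) :
    \big[op/idx]_(X in [set X in us]) F X = \big[op/idx]_(X <- us) F X.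
  by rewrite big_uniq //=; apply: eq_bigl => X; rewrite inE.
by rewrite /cover !big_us.
Qed.


Lemma sum_wt us : \sum_(X <- us) wt X = n.+1 * \sum_(X <- us) #|X| + size us.
Proof.
elim: us => [|U us IH]; first by rewrite !big_nil muln0.
by rewrite !big_cons IH /wt /=; lia.
Qed.

Lemma wins_uniq us q : uniq us ->
  wins eta [set X in us] q = count (fun U => eta U == q :> nat) us.
Proof.
move=> us_uniq; rewrite /wins -size_filter -(card_uniqP (filter_uniq _ us_uniq)).
by apply: eq_card => U; rewrite inE mem_filter inE andbC.
Qed.

Lemma partition_wt us k : k <= n -> all (fun U => U != set0) us ->
    \bigcup_(X <- us) X = setT -> \sum_(X <- us) wt X = n * n.+1 + k ->
  [/\ uniq us, size us = k & partition [set X in us] [set: 'I_n]].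
Proof.
move=> kn us0 cov; rewrite sum_wt => sz.
have le1 : n <= \sum_(X <- us) #|X|.
  rewrite -[leqLHS]card_ord -cardsT -cov.
  elim: us {us0 cov sz} => [|X us IH]; first by rewrite !big_nil cards0.
  rewrite !big_cons (leq_trans (leq_card_setU _ _).1) //.
  by rewrite leq_add2l.
have sE : \sum_(X <- us) #|X| = n.
  by apply/eqP; rewrite eqn_leq le1 andbT; nia.
have [un tr] : uniq us /\ trivIset [set X in us].
  by apply: uniq_disjoint_sum; rewrite // sE cov cardsT card_ord.
split=> //; first by move: sz; rewrite sE; lia.
apply/and3P; split=> //; last by rewrite inE; apply/negP => /(allP us0); rewrite eqxx.
apply/eqP/setP => x; rewrite in_setT /cover; move: (in_setT x); rewrite -cov bigcup_seq.
by case/bigcupP=> X Xus xX; apply/bigcupP; exists X; rewrite ?inE.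
Qed.

Fixpoint blocks (P : {set {set 'I_n}}) (j : nat) : seq {set 'I_n} :=
  if j is j1.+1 then enum [set U in P | eta U == j1 :> nat] ++ blocks P j1 else [::].

Lemma perm_blocks P j : perm_eq (blocks P j) (enum [set U in P | eta U < j]).
Proof.
elim: j => [|j IH] /=.
  by rewrite (_ : [set U in P | _] = set0) ?enum_set0 //; apply/setP => U; rewrite !inE andbF.
rewrite (perm_catl _ IH); apply: uniq_perm; rewrite ?enum_uniq //.
  rewrite cat_uniq !enum_uniq andbT /=; apply/hasPn => U.
  by rewrite !mem_enum !inE => /andP[-> /=]; case: ltngtP.
by move=> U; rewrite mem_cat !mem_enum !inE -andb_orr ltnS [eta U <= j]leq_eqVlt.
Qed.

Lemma fills_blocks (P : {set {set 'I_n}}) p t j : {in P, forall U, district I U} ->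
    (forall q : nat, q < m -> q != p ->
       #|[set U in P | eta U == q :> nat]| <= t) ->
    #|[set U in P | eta U == p :> nat]| = t.+1 ->
  j <= m -> fills (slots p t j) (blocks P j).
Proof.
move=> dP le eq; elim: j => [|j IH] //= jm; apply: fills_cat; last exact/IH/ltnW.
apply: fills_nseq; rewrite -?cardE.
- by apply/allP => U; rewrite mem_enum inE => /andP[/dP].
- by apply/allP => U; rewrite mem_enum inE => /andP[].
- by case: (eqVneq j p) => [->|jp]; [rewrite eq addn1|rewrite addn0 le].
- by rewrite negbK => /eqP ->; rewrite eq eqxx addn1.
Qed.

Lemma district_neq0 us : all (district I) us -> all (fun U => U != set0) us.
Proof. by apply: sub_all => U /districtP[]. Qed.

Lemma wgm_yes_coverable : wgm_yes I eta =
  (nb_districts I <= n) && has (fun t => coverable (slots (target I) t m)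
     (n * n.+1 + nb_districts I) setT) (iota 0 n).
Proof.
apply/existsP/andP => [[P /and4P[pP /eqP kP /forall_inP dP /forall_inP wP]]|].
  have kn : nb_districts I <= n.
    rewrite -kP -[leqRHS]card_ord -cardsT (card_partition pP) -sum1_card leq_sum // => U UP.
    by rewrite card_gt0; have /districtP[] := dP U UP.
  split=> //; pose t := (wins eta P (target I)).-1.
  have w_gt0 : 0 < wins eta P (target I).
    have /set0Pn[U UP] : P != set0 by rewrite -card_gt0 kP nb_districts_gt0.
    have [eU|eU] := eqVneq (eta U) (target I); last exact: leq_ltn_trans (wP _ eU).
    by rewrite card_gt0; apply/set0Pn; exists U; rewrite inE UP eU eqxx.
  have tn : t < n.
    rewrite /t prednK //; apply: leq_trans kn; rewrite -kP.
    by apply: subset_leq_card; apply/subsetP => U; rewrite inE => /andP[].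
  apply/hasP; exists t; first by rewrite mem_iota.
  apply/coverableP; exists (blocks P m).
  have pE : perm_eq (blocks P m) (enum P).
    rewrite (perm_trans (perm_blocks _ _)) // (_ : [set U in P | _] = P) //.
    by apply/setP => U; rewrite inE ltn_ord andbT.
  split.
  - apply: fills_blocks => //; last by rewrite /t prednK.
    move=> q qm qp; rewrite /t -ltnS prednK //.
    exact: (wP (Ordinal qm)).
  - by rewrite (perm_big _ pE) big_enum; have /and3P[/eqP] := pP.
  - rewrite sum_wt (perm_size pE) -cardE kP (perm_big _ pE) big_enum /=.
    by rewrite -(card_partition pP) cardsT card_ord mulnC.
case=> kn /hasP[t _ /coverableP[us [fus cov sz]]].
have dus := fills_district fus.
have [un size_us pus] := partition_wt kn (district_neq0 dus) cov sz.
exists [set X in us]; apply/and4P; split=> //.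
- by rewrite cardsE (card_uniqP un) size_us.
- by apply/forall_inP => U; rewrite inE => /(allP dus).
apply/forall_inP => q qp; rewrite !wins_uniq //.
have := fills_count_le q fus; have := fills_count_ge (target I) fus.
rewrite count_slots count_target_slots !ltn_ord (_ : (q == target I :> nat) = false); first lia.
exact/negbTE.
Qed.

End Slots.

(** * The program *)

Declare Scope expr_scope.
Delimit Scope expr_scope with X.
Bind Scope expr_scope with expr.
Notation "x + y" := (Bin OpAdd x y) : expr_scope.
Notation "x - y" := (Bin OpSub x y) : expr_scope.
Notation "x * y" := (Bin OpMul x y) : expr_scope.
Notation "x %/ y" := (Bin OpDiv x y) : expr_scope.
Notation "x %% y" := (Bin OpMod x y) : expr_scope.
Notation "x == y" := (Bin OpEq x y) : expr_scope.
Notation "x < y" := (Bin OpLt x y) : expr_scope.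
Coercion Const : nat >-> expr.
Notation "c1 ;; c2" := (Sq c1 c2) (at level 60, right associativity).

Notation r_ans := 0 (only parsing).
Notation r_n := 1 (only parsing).
Notation r_m := 2 (only parsing).
Notation r_p := 3 (only parsing).
Notation r_k := 4 (only parsing).
Notation r_N := 5 (only parsing).
Notation r_G := 6 (only parsing).
Notation r_M := 7 (only parsing).
Notation r_L := 8 (only parsing).
Notation r_i := 9 (only parsing).
Notation r_y := 10 (only parsing).
Notation r_h := 11 (only parsing).
Notation r_acc := 12 (only parsing).
Notation r_t := 13 (only parsing).
Notation r_q := 14 (only parsing).
Notation r_s := 15 (only parsing).

(* Six interleaved tables start at address [L]: the unions reached so far (T), the
   transforms of T and of the districts won by the current candidate (A, B), their
   product (C), the districts (D) and the powers of 2 (P). *)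
Definition cell_at (a : nat) (e : expr) : expr := (Reg r_L + (6 * e + a))%X.
Definition cell (a : nat) (e : expr) : expr := Fetch (cell_at a e).

Notation tT := 0 (only parsing).
Notation tA := 1 (only parsing).
Notation tB := 2 (only parsing).
Notation tC := 3 (only parsing).
Notation tD := 4 (only parsing).
Notation tP := 5 (only parsing).

Definition bit (y v : expr) : expr := ((y %/ cell tP v) %% 2)%X.

Definition each_cell (c : stmt) : stmt := For r_y r_M c.
Definition write (a : nat) (e : expr) : stmt := Sto (cell_at a (Reg r_y)) e.

Definition header_prog : stmt :=
  Asg r_n (Fetch 0) ;; Asg r_m (Fetch 1) ;; Asg r_p (Fetch 2) ;; Asg r_k (Fetch 3) ;;
  Asg r_L (4 + Reg r_n * Reg r_n)%X ;; Asg r_N 1.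

Definition powers_prog : stmt :=
  For r_i r_n (Sto (cell_at tP (Reg r_i)) (Reg r_N) ;; Asg r_N (Reg r_N * 2)%X).

Definition sizes_prog : stmt :=
  Asg r_G ((Reg r_n + 1) * (Reg r_n + 1))%X ;; Asg r_M (Reg r_G * Reg r_N)%X.

Definition district_test : stmt :=
  Cnd (bit (Reg r_y) (Reg r_i))
    (Cnd (Reg r_y == (Reg r_n + 2) * Reg r_N + cell tP (Reg r_i))%X (Asg r_acc 1) ;;
     Cnd ((Reg r_y < (Reg r_n + 1) * Reg r_N + cell tP (Reg r_i)) == 0)%X
       (Cnd (cell tD (Reg r_y - ((Reg r_n + 1) * Reg r_N + cell tP (Reg r_i)))
             * (bit (Reg r_y) (Reg r_h) * Fetch (4 + (Reg r_h * Reg r_n + Reg r_i))))%X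
          (Asg r_acc 1))).

Definition districts_prog : stmt :=
  each_cell (Asg r_acc 0 ;; For r_i r_n (For r_h r_n district_test) ;; write tD (Reg r_acc)).

Definition zeta_prog (a : nat) : stmt :=
  For r_i r_n (each_cell (write a
    (cell a (Reg r_y) + bit (Reg r_y) (Reg r_i) *
       cell a (Reg r_y - bit (Reg r_y) (Reg r_i) * cell tP (Reg r_i)))%X)).

Definition mobius_prog (a : nat) : stmt :=
  let v := (Reg r_n - (Reg r_i + 1))%X in
  For r_i r_n (each_cell (write a
    (cell a (Reg r_y) - bit (Reg r_y) v * cell a (Reg r_y - bit (Reg r_y) v * cell tP v))%X)).

Definition product_prog : stmt :=
  each_cell
    (Asg r_acc 0 ;;
     For r_h r_G (Cnd ((Reg r_y < Reg r_h * Reg r_N) == 0)%X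
       (Asg r_acc (Reg r_acc + cell tA (Reg r_y - Reg r_h * Reg r_N) *
                               cell tB (Reg r_h * Reg r_N + Reg r_y %% Reg r_N))%X)) ;;
     write tC (Reg r_acc)).

Definition copy_prog : stmt := each_cell (write tA (cell tT (Reg r_y))).

Definition winners_prog : stmt :=
  each_cell (Qry r_acc (Reg r_y) ;;
             write tB (cell tD (Reg r_y) * (Reg r_acc == Reg r_q))%X).

Definition clip_prog : stmt :=
  each_cell (write tT
    (0 < cell tT (Reg r_y) * ((Reg r_q == Reg r_p) == 0) + cell tC (Reg r_y))%X).

Definition slot_prog : stmt :=
  copy_prog ;; zeta_prog tA ;; winners_prog ;; zeta_prog tB ;;
  product_prog ;; mobius_prog tC ;; clip_prog.

Definition main_prog : stmt :=
  For r_t r_n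
    (each_cell (write tT (Reg r_y == 0)%X) ;;
     For r_q r_m (For r_s r_n
       (Cnd (Reg r_s < Reg r_t + (Reg r_q == Reg r_p))%X slot_prog)) ;;
     Cnd (Reg r_k < Reg r_n + 1)%X
       (Cnd (cell tT ((Reg r_n * (Reg r_n + 1) + Reg r_k) * Reg r_N + (Reg r_N - 1)))%X
          (Asg r_ans 1))).

Definition gm_prog : cmd :=
  Seq (compile header_prog) (Seq (compile powers_prog) (Seq (compile sizes_prog)
    (compile (districts_prog ;; main_prog)))).

Section Eval.
Variables (w : nat) (s : state).
Implicit Types (e : expr) (x y : nat).

Lemma ev_const x : x < 2 ^ w -> eval w s x = x.
Proof. exact: modn_small. Qed.

Lemma ev_add e1 e2 x y : eval w s e1 = x -> eval w s e2 = y -> x + y < 2 ^ w ->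
  eval w s (e1 + e2)%X = x + y.
Proof. by move=> /= -> ->; exact: modn_small. Qed.

Lemma ev_mul e1 e2 x y : eval w s e1 = x -> eval w s e2 = y -> x * y < 2 ^ w ->
  eval w s (e1 * e2)%X = x * y.
Proof. by move=> /= -> ->; exact: modn_small. Qed.

Lemma ev_sub e1 e2 x y : eval w s e1 = x -> eval w s e2 = y -> y <= x < 2 ^ w ->
  eval w s (e1 - e2)%X = x - y.
Proof.
move=> /= -> -> /andP[yx xw]; rewrite addnBA; last by apply: ltnW; apply: leq_ltn_trans xw.
by rewrite addnC -addnBA // modnDl modn_small // (leq_ltn_trans (leq_subr _ _)).
Qed.

Lemma ev_guard e1 e2 (b : bool) x : eval w s e1 = b -> (b -> eval w s e2 = x) ->
  b * x < 2 ^ w -> eval w s (e1 * e2)%X = b * x.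
Proof.
move=> E1; case: b E1 => E1 E2 lt; first exact: ev_mul (E2 isT) lt.
by rewrite /= E1 !mul0n mod0n.
Qed.

Lemma ev_lt e1 e2 x y : eval w s e1 = x -> eval w s e2 = y ->
  eval w s (e1 < e2)%X = (x < y).
Proof. by move=> /= -> ->. Qed.

Lemma ev_eq e1 e2 x y : eval w s e1 = x -> eval w s e2 = y ->
  eval w s (e1 == e2)%X = (x == y).
Proof. by move=> /= -> ->. Qed.

Lemma ev_mod e1 e2 x y : eval w s e1 = x -> eval w s e2 = y ->
  eval w s (e1 %% e2)%X = x %% y.
Proof. by move=> /= -> ->. Qed.

Lemma ev_reg r x : reg s r = x -> eval w s (Reg r) = x.
Proof. by []. Qed.

End Eval.

Lemma upd_at f i x j : upd f i x j = if j == i then x else f j.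
Proof. by []. Qed.

Section Tables.
Variable L : nat.

Definition addr a y := L + (6 * y + a).

Definition patch (mu : nat -> nat) a (f : nat -> nat) k x :=
  if [&& L <= x, (x - L) %% 6 == a & (x - L) %/ 6 < k] then f ((x - L) %/ 6) else mu x.

Lemma addr_mod a y : a < 6 -> (addr a y - L) %% 6 = a.
Proof. by move=> a6; rewrite /addr addKn mulnC modnMDl modn_small. Qed.

Lemma addr_div a y : a < 6 -> (addr a y - L) %/ 6 = y.
Proof. by move=> a6; rewrite /addr addKn mulnC divnMDl // divn_small ?addn0. Qed.

Lemma patch_addr mu a f k b y : b < 6 ->
  patch mu a f k (addr b y) = if (b == a) && (y < k) then f y else mu (addr b y).
Proof. by move=> b6; rewrite /patch addr_mod // addr_div // leq_addr. Qed.

Lemma patch_below mu a f k x : x < L -> patch mu a f k x = mu x.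
Proof. by move=> xL; rewrite /patch leqNgt xL. Qed.

Lemma patch0 mu a f : patch mu a f 0 =1 mu.
Proof. by move=> x; rewrite /patch ltn0 !andbF. Qed.

Lemma patchS mu a f k : a < 6 ->
  upd (patch mu a f k) (addr a k) (f k) =1 patch mu a f k.+1.
Proof.
move=> a6 x; rewrite upd_at; case: eqP => [->|ne].
  by rewrite patch_addr // eqxx ltnSn.
rewrite /patch; case: (leqP L x) => //= Lx; case: eqP => //= xa.
rewrite ltnS; case: ltngtP => //= xk.
by case: ne; rewrite /addr; have := divn_eq (x - L) 6; lia.
Qed.

Lemma patch_id mu a f k : a < 6 -> (forall y, y < k -> f y = mu (addr a y)) ->
  patch mu a f k =1 mu.
Proof.
move=> a6 fE x; rewrite /patch; case: ifP => // /and3P[Lx /eqP xa xk]; rewrite fE //.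
by congr mu; rewrite /addr; have := divn_eq (x - L) 6; lia.
Qed.

Lemma patch_patch mu nu a f g k : nu =1 patch mu a f k ->
  patch nu a g k =1 patch mu a g k.
Proof.
by move=> nuE x; rewrite /patch; case: ifP => // C; rewrite nuE /patch C.
Qed.

Lemma eq_patch mu nu a f g k : mu =1 nu -> (forall y, y < k -> f y = g y) ->
  patch mu a f k =1 patch nu a g k.
Proof. by move=> E F x; rewrite /patch E; case: ifP => // /and3P[_ _ /F]. Qed.

End Tables.

(** * Correctness of the program *)

Local Notation memory := Defs.mem.

Section Verification.
Variables (n m : nat) (I : wgm 'I_n 'I_m) (eta : {set 'I_n} -> 'I_m) (w : nat).
Implicit Types (U W A B : {set 'I_n}) (s : state) (mu : nat -> nat) (y g h : nat).

Let N := 2 ^ n.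
Let G := n.+1 * n.+1.
Let M := G * N.
Let L := 4 + n * n.
Let p := nat_of_ord (target I).
Let k := nb_districts I.

Hypotheses (roomy : 32 * (G * (N * N)) < 2 ^ w) (m_lt : m < 2 ^ w) (k_lt : k < 2 ^ w).

Local Notation run := (run w (rule_oracle eta)).
Local Notation addr := (addr L).
Local Notation patch := (patch L).

Lemma N_gt0 : 0 < N. Proof. by rewrite expn_gt0. Qed.

Lemma sizes : [/\ n < N, 0 < G, N <= M, n < G & M <= G * (N * N)].
Proof.
have h := N_gt0; have nN : n < N by rewrite ltn_expl.
have G0 : 0 < G by [].
have nG : n < G by rewrite /G; nia.
split=> //; first by rewrite /M leq_pmull.
by rewrite /M mulnA leq_pmulr.
Qed.

Lemma M_lt : L + (6 * M + 6) < 2 ^ w.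
Proof.
have [_ _ NM nG MG] := sizes; have h := N_gt0.
have : L <= 4 + G by rewrite /L /G; nia.
have : G <= M by rewrite /M leq_pmulr.
lia.
Qed.

Definition ctx s := [/\ reg s r_n = n, reg s r_m = m & reg s r_p = p] /\
  [/\ reg s r_k = k, reg s r_N = N, reg s r_G = G, reg s r_M = M & reg s r_L = L].

Lemma ctx_frame s s' : (forall x, x < 9 -> x != 0 -> reg s' x = reg s x) -> ctx s -> ctx s'.
Proof. by move=> fr; rewrite /ctx !fr. Qed.

Definition fresh (c : stmt) := all (fun x => (x == 0) || (x \notin mods c)) (iota 0 9).

Lemma freshP c x : fresh c -> x < 9 -> x != 0 -> x \notin mods c.
Proof.
by move=> /allP h x9 x0; have := h x; rewrite mem_iota (negbTE x0) => /(_ x9).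
Qed.

Lemma ctx_run c s : fresh c -> ctx s -> ctx (run c s).
Proof. by move=> fc; apply: ctx_frame => x x9 x0; rewrite run_frame ?(freshP fc). Qed.

Lemma for_ctx r b c s s' : fresh (For r b c) -> ctx s ->
  (forall x, x != r -> x \notin mods c -> reg s' x = reg s x) -> ctx s'.
Proof.
move=> fc cs fr; apply: ctx_frame cs => x x9 x0.
by have := freshP fc x9 x0; rewrite inE negb_or => /andP[]; exact: fr.
Qed.

Lemma each_cellP a (f : nat -> nat) c s : a < 6 -> ctx s -> fresh (each_cell c) -> r_y \notin mods c ->
    (forall y s', y < M -> reg s' r_y = y -> ctx s' ->
       (forall x, x != r_y -> x \notin mods c -> reg s' x = reg s x) ->
       memory s' =1 patch (memory s) a f y ->
       memory (run c s') =1 upd (memory s') (addr a y) (f y)) ->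
  memory (run (each_cell c) s) =1 patch (memory s) a f M.
Proof.
move=> a6 cs fc yc step.
have rM : reg s r_M = M by have [_ []] := cs.
rewrite -[in patch _ _ _ M]rM.
apply: (run_for (Inv := fun y s' => memory s' =1 patch (memory s) a f y)) => //.
- by rewrite rM; have := M_lt; lia.
- by move=> x; rewrite patch0.
move=> y s' yM ry fr ms' x; rewrite rM in yM.
rewrite /= (step y s' yM ry (for_ctx fc cs fr) fr ms').
by rewrite -patchS // !upd_at ms'.
Qed.

Lemma ev_cell_at s a e y : reg s r_L = L -> a < 6 -> eval w s e = y -> y <= M ->
  eval w s (cell_at a e) = addr a y.
Proof.
move=> rL a6 ey yM; have lt := M_lt.
apply: ev_add => //; last lia.
apply: ev_add; [apply: ev_mul => //; last lia|apply: ev_const; lia|lia].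
by apply: ev_const; lia.
Qed.

Lemma ev_cell s a e y : ctx s -> a < 6 -> eval w s e = y -> y <= M ->
  eval w s (cell a e) = memory s (addr a y).
Proof. by move=> [_ [_ _ _ _ rL]] a6 ey yM; rewrite -(ev_cell_at rL a6 ey yM). Qed.

Lemma run_write s a e y : ctx s -> a < 6 -> reg s r_y = y -> y <= M ->
  memory (run (write a e) s) = upd (memory s) (addr a y) (eval w s e).
Proof.
by move=> [_ [_ _ _ _ rL]] a6 ry yM; rewrite -(ev_cell_at (e := Reg r_y) rL a6 _ yM).
Qed.

Definition menv mu := forall v, v < n -> mu (addr tP v) = 2 ^ v.

Lemma menv_patch mu a f b : a < 5 -> menv mu -> menv (patch mu a f b).
Proof.
move=> a5 me v vn; rewrite patch_addr // gtn_eqF ?me //.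
Qed.

Lemma eq_menv mu nu : mu =1 nu -> menv nu -> menv mu.
Proof. by move=> E me v vn; rewrite E me. Qed.

Lemma ev_pow s e (v : 'I_n) : ctx s -> menv (memory s) -> eval w s e = v ->
  eval w s (cell tP e) = 2 ^ v.
Proof.
move=> cs me ev; rewrite (ev_cell (y := v)) // ?me //.
by have [nN _ NM _ _] := sizes; have := ltn_ord v; lia.
Qed.

Lemma ev_bit s ey ev y (v : 'I_n) : ctx s -> menv (memory s) ->
  eval w s ey = y -> eval w s ev = v -> eval w s (bit ey ev) = (v \in vset n y).
Proof.
move=> cs me Ey Ev; rewrite -bit_vset; apply: ev_mod; last first.
  by apply: ev_const; have := M_lt; lia.
by rewrite /= -/(cell_at _ _) -/(cell tP ev) -[memory _ _]/(eval w s (cell tP ev)) (ev_pow cs me Ev) Ey.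
Qed.

Lemma bit_pow_le y (v : 'I_n) : (v \in vset n y) * 2 ^ v <= y.
Proof.
case vy: (v \in _) => //; rewrite mul1n -[leqRHS](idxE n) /idx (word_D1 vy); lia.
Qed.

Definition zeta_tab i (f : nat -> nat) y :=
  zeta i (fun W => f (idx (deg n y) W)) (vset n y).

Lemma zeta_tabS (v : 'I_n) f y : let b := v \in vset n y in
  zeta_tab v.+1 f y = zeta_tab v f y + b * zeta_tab v.+1 f (y - b * 2 ^ v).
Proof.
rewrite /= /zeta_tab zetaS; case vy: (v \in _) => //=; rewrite !mul1n.
by rewrite sub_pow // deg_idx vset_idx zetaS_D1.
Qed.

Lemma zeta_tab_mobius (v : 'I_n) f y : let b := v \in vset n y in
  zeta_tab v f y = zeta_tab v.+1 f y - b * zeta_tab v f (y - b * 2 ^ v).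
Proof.
rewrite /= zeta_tabS /zeta_tab; case vy: (v \in _); rewrite ?mul0n ?addn0 ?subn0 // !mul1n.
by rewrite sub_pow // deg_idx vset_idx zetaS_D1 addnK.
Qed.

Lemma zeta_tab0 f y : zeta_tab 0 f y = f y.
Proof. by rewrite /zeta_tab zeta0 idxE. Qed.

Lemma zeta_progP a s : a < 5 -> ctx s -> menv (memory s) ->
    (forall y, y < M -> memory s (addr a y) <= 1) ->
  memory (run (zeta_prog a) s) =1 patch (memory s) a (zeta_tab n (fun y => memory s (addr a y))) M.
Proof.
move=> a5 cs me s01; have a6 : a < 6 by lia.
set f := fun y => _; have rn : reg s r_n = n by case: cs => -[].
have fz i y : y < M -> zeta_tab i f y <= N.
  by move=> yM; rewrite -[N]muln1; apply: zeta_le => W; apply: s01; rewrite idx_lt deg_lt.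
have lt := M_lt; have [nN _ NM _ _] := sizes.
rewrite -[in zeta_tab n]rn /zeta_prog.
refine (run_for (Inv := fun i s' => memory s' =1 patch (memory s) a (zeta_tab i f) M)
  (b := r_n) _ _ _ _) => //.
- by rewrite rn; lia.
- by move=> x; rewrite patch_id // => y _; rewrite zeta_tab0.
move=> i s1 + ri fr ms1 x; rewrite rn => lt_in; pose v := Ordinal lt_in.
have cs1 : ctx s1 by apply: (for_ctx (b := r_n)) fr.
rewrite -(patch_patch _ ms1); move: x; apply: each_cellP => //.
move=> y s2 yM ry cs2 fr2 ms2 z.
have Ey : eval w s2 (Reg r_y) = y by [].
have Ei : eval w s2 (Reg r_i) = v by rewrite /= fr2.
have me2 : menv (memory s2).
  by apply: (eq_menv ms2); apply: menv_patch => //; apply: (eq_menv ms1); exact: menv_patch.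
have Eb := ev_bit cs2 me2 Ey Ei; have Ep := ev_pow cs2 me2 Ei.
have ble := bit_pow_le y v; have zS := zeta_tabS v f y; rewrite /= in zS.
have tabE u : u <= y -> memory s2 (addr a u) = zeta_tab (if u < y then v.+1 else v) f u.
  move=> uy; rewrite ms2 patch_addr // eqxx /= ms1 patch_addr // eqxx.
  by case: ltnP => //; case: ltnP => //; lia.
rewrite (run_write _ cs2 a6 ry (ltnW yM)) !upd_at; congr (if _ then _ else _).
have fzy := fz v.+1 y yM; rewrite zS in fzy *.
apply: ev_add; last by lia.
  by rewrite (ev_cell (y := y)) ?tabE ?ltnn // ltnW.
apply: ev_guard; [exact: Eb|move=> vy|by lia].
have pv : 0 < 2 ^ v by rewrite expn_gt0.
rewrite vy !mul1n in ble *.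
rewrite (ev_cell (y := y - 2 ^ v)) //; last by lia.
  by rewrite tabE ?leq_subr // (_ : _ < _) //; lia.
apply: ev_sub => //; last by lia.
by rewrite -[RHS]mul1n; apply: ev_mul; rewrite ?Eb ?vy //; lia.
Qed.

Lemma run_Cnd e c s : run (Cnd e c) s = if eval w s e != 0 then run c s else s.
Proof. by []. Qed.

Lemma mobius_progP a c s : a < 5 -> ctx s -> menv (memory s) ->
    (forall y, y < M -> memory s (addr a y) = zeta_tab n c y) ->
    (forall y, y < M -> zeta_tab n c y < 2 ^ w) ->
  memory (run (mobius_prog a) s) =1 patch (memory s) a c M.
Proof.
move=> a5 cs me sE sw; have a6 : a < 6 by lia.
have rn : reg s r_n = n by case: cs => -[].
have lt := M_lt; have [nN _ NM _ _] := sizes.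
have fin : patch (memory s) a (zeta_tab (n - reg s r_n) c) M =1 patch (memory s) a c M.
  by rewrite rn subnn; apply: eq_patch => // y _; exact: zeta_tab0.
move=> x; rewrite -fin; move: x; rewrite /mobius_prog.
refine (run_for (Inv := fun i s' => memory s' =1 patch (memory s) a (zeta_tab (n - i) c) M)
  (b := r_n) _ _ _ _) => //.
- by rewrite rn; lia.
- by move=> x; rewrite subn0 patch_id // => y yM; rewrite sE.
move=> i s1 + ri fr ms1 x; rewrite rn => lt_in.
have lt_vn : n - i.+1 < n by lia.
have [v v_i] : exists v : 'I_n, v = n - i.+1 :> nat by exists (Ordinal lt_vn).
have vE : n - i = v.+1 by lia.
have cs1 : ctx s1 by apply: (for_ctx (b := r_n)) fr.
rewrite vE in ms1; rewrite -v_i -(patch_patch _ ms1); move: x; apply: each_cellP => //.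
move=> y s2 yM ry cs2 fr2 ms2 z.
have Ey : eval w s2 (Reg r_y) = y by [].
have Ei : eval w s2 (Reg r_n - (Reg r_i + 1))%X = v.
  have ei : eval w s2 (Reg r_i) = i by rewrite /= fr2.
  have en : eval w s2 (Reg r_n) = n by case: cs2 => -[].
  have -> : nat_of_ord v = n - (i + 1) by rewrite addn1 v_i.
  apply: ev_sub => //; last by lia.
  by apply: ev_add => //; [apply: ev_const; lia|lia].
have me2 : menv (memory s2).
  by apply: (eq_menv ms2); apply: menv_patch => //; apply: (eq_menv ms1); exact: menv_patch.
have Eb := ev_bit cs2 me2 Ey Ei; have Ep := ev_pow cs2 me2 Ei.
have ble := bit_pow_le y v; have zS := zeta_tab_mobius v c y; rewrite /= in zS.
have zS' := zeta_tabS v c y; rewrite /= in zS'.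
have tabE u : u <= y -> memory s2 (addr a u) = zeta_tab (if u < y then v : nat else v.+1) c u.
  move=> uy; rewrite ms2 patch_addr // eqxx /= ms1 patch_addr // eqxx.
  by case: ltnP => //; case: ltnP => //; lia.
rewrite (run_write _ cs2 a6 ry (ltnW yM)) !upd_at; congr (if _ then _ else _).
have zv : zeta_tab v.+1 c y < 2 ^ w by apply: leq_ltn_trans (sw _ yM); exact: zeta_le_full.
have bz : (v \in vset n y) * zeta_tab v c (y - (v \in vset n y) * 2 ^ v) <= zeta_tab v.+1 c y.
  rewrite zS' /zeta_tab; case vy: (v \in _); rewrite // !mul1n.
  by rewrite sub_pow // deg_idx vset_idx zetaS_D1 leq_addl.
rewrite zS; apply: ev_sub; last by rewrite bz.
  by rewrite (ev_cell (y := y)) ?tabE ?ltnn // ltnW.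
apply: ev_guard; [exact: Eb|move=> vy|by lia].
have pv : 0 < 2 ^ v by rewrite expn_gt0.
rewrite vy !mul1n in ble *.
rewrite (ev_cell (y := y - 2 ^ v)) //; last by lia.
  by rewrite tabE ?leq_subr // (_ : _ < _) //; lia.
apply: ev_sub => //; last by lia.
by rewrite -[RHS]mul1n; apply: ev_mul; rewrite ?Eb ?vy //; lia.
Qed.

Definition prod_tab (f b : nat -> nat) y :=
  \sum_(h < (deg n y).+1) f (idx (deg n y - h) (vset n y)) * b (idx h (vset n y)).

Lemma product_progP s : ctx s ->
    (forall y, y < M -> memory s (addr tA y) <= N) ->
    (forall y, y < M -> memory s (addr tB y) <= N) ->
  memory (run product_prog s) =1
    patch (memory s) tC (prod_tab (fun y => memory s (addr tA y)) (fun y => memory s (addr tB y))) M.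
Proof.
move=> cs sA sB; set f := fun y => memory s (addr tA y); set b := fun y => memory s (addr tB y).
have lt := M_lt; have [nN _ NM _ MG] := sizes.
apply: each_cellP => // y s1 yM ry cs1 fr1 ms1 x.
have dG : deg n y < G by rewrite deg_lt.
pose term h := f (idx (deg n y - h) (vset n y)) * b (idx h (vset n y)).
have term_le h : h <= deg n y -> term h <= N * N.
  move=> hd; apply: leq_mul; [apply: sA|apply: sB]; rewrite idx_lt; lia.
pose part j := \sum_(h < j) (h < (deg n y).+1) * term h.
have part_le j : j <= G -> part j <= G * (N * N).
  move=> jG; apply: leq_trans (_ : \sum_(h < j) N * N <= _).
    apply: leq_sum => h _; case: ltnP => // hd; rewrite mul1n; exact: term_le.
  by rewrite sum_nat_const card_ord leq_mul2r jG orbT.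
set c := For r_h r_G _; set s2 := run (Asg r_acc 0) s1.
have cs2 : ctx s2 by exact: ctx_run.
have rG : reg s2 r_G = G by case: cs2 => _ [].
have [ms3 acc3] : memory (run c s2) = memory s1 /\ reg (run c s2) r_acc = part (reg s2 r_G).
  refine (run_for (Inv := fun j s' => memory s' = memory s1 /\ reg s' r_acc = part j)
    (b := r_G) _ _ _ _) => //.
  - by rewrite rG; lia.
  - by split=> //; rewrite /s2 /= /upd /= mod0n /part big_ord0.
  move=> h s3 + rh fr3 [ms3 acc3]; rewrite rG => hG.
  have cs3 : ctx s3 by apply: (for_ctx (b := r_G)) fr3.
  have ry3 : reg s3 r_y = y by rewrite fr3 // /s2 /= /upd /=.
  have rN : reg s3 r_N = N by case: cs3 => _ [].
  have hN : h * N + N <= M by rewrite -mulSnr leq_mul2r hG orbT.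
  have EhN : eval w s3 (Reg r_h * Reg r_N)%X = h * N by apply: ev_mul => //; lia.
  have Ec : eval w s3 ((Reg r_y < Reg r_h * Reg r_N) == 0)%X = (h < (deg n y).+1).
    rewrite (ev_eq (ev_lt (ev_reg _ ry3) EhN) (ev_const (x := 0) _ _)); last by lia.
    by rewrite -deg_lt ltnS; case: leqP.
  have partS : part h.+1 = part h + (h < (deg n y).+1) * term h by rewrite /part big_ord_recr.
  have pG := part_le _ hG; rewrite partS in pG *.
  rewrite run_Cnd Ec; case: (ltnP h) pG => /= hd; last by rewrite mul0n addn0.
  rewrite mul1n => pG; split=> //.
  have hy : h * N <= y by rewrite leqNgt -deg_lt -leqNgt.
  have Eh : eval w s3 (cell tA (Reg r_y - Reg r_h * Reg r_N))
      = f (idx (deg n y - h) (vset n y)).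
    rewrite -idx_sub // idxE; apply: etrans (ev_cell (y := y - h * N) _ _ _ _) _ => //.
    - by apply: ev_sub => //; lia.
    - lia.
    - by rewrite ms3 ms1 patch_addr.
  have Em : eval w s3 (cell tB (Reg r_h * Reg r_N + Reg r_y %% Reg r_N)) = b (idx h (vset n y)).
    have iM : idx h (vset n y) < M by rewrite idx_lt.
    apply: etrans (ev_cell (y := idx h (vset n y)) _ _ _ _) _ => //.
    - rewrite /idx word_set; apply: ev_add => //; first exact: ev_mod.
      by move: iM; rewrite /idx word_set /N; lia.
    - exact: ltnW.
    - by rewrite ms3 ms1 patch_addr.
  suff : eval w s3 (Reg r_acc + cell tA (Reg r_y - Reg r_h * Reg r_N) *
    cell tB (Reg r_h * Reg r_N + Reg r_y %% Reg r_N))%X = part h + term h by [].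
  by apply: ev_add; [exact: acc3|apply: ev_mul; [exact: Eh|exact: Em|]|]; rewrite -/(term h); lia.
rewrite rG in acc3.
have cs4 : ctx (run c s2) by exact: ctx_run.
rewrite [run _ s1](_ : _ = run (write tC (Reg r_acc)) (run c s2)) //.
rewrite (run_write _ (y := y)) //; last exact: ltnW.
  rewrite ms3 !upd_at; congr (if _ then _ else _).
  rewrite [LHS]acc3 /prod_tab (big_ord_widen G term) // [RHS]big_mkcond.
  by apply: eq_bigr => h _; case: ifP => _; rewrite ?mul1n.
by rewrite run_frame // /s2 /= /upd.
Qed.

Definition dist_tab y : bool := district I (vset n y) && (deg n y == wt (vset n y)).

Definition env mu := menv mu /\ forall y, y < M -> mu (addr tD y) = dist_tab y.

Lemma eq_env mu nu : mu =1 nu -> env nu -> env mu.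
Proof.
by move=> E [me dE]; split; [exact: eq_menv me|move=> y yM; rewrite E dE].
Qed.

Lemma env_patch mu a f b : a < 4 -> env mu -> env (patch mu a f b).
Proof.
move=> a4 [me dE]; split; first by apply: menv_patch => //; lia.
by move=> y yM; rewrite patch_addr // gtn_eqF ?dE.
Qed.

Definition table_of sl mu :=
  forall y, y < M -> mu (addr tT y) = coverable I eta sl (deg n y) (vset n y).

Lemma idx_M y W : y < M -> idx (deg n y) W < M.
Proof. by move=> yM; rewrite idx_lt deg_lt. Qed.

Lemma zeta_tab_eq f1 f2 i y : y < M -> (forall z, z < M -> f1 z = f2 z) ->
  zeta_tab i f1 y = zeta_tab i f2 y.
Proof. by move=> yM E; apply: eq_bigr => W _; apply: E; exact: idx_M. Qed.

Lemma copy_progP s : ctx s ->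
  memory (run copy_prog s) =1 patch (memory s) tA (fun y => memory s (addr tT y)) M.
Proof.
move=> cs; apply: each_cellP => // y s1 yM ry cs1 fr1 ms1 z.
rewrite (run_write _ cs1 _ ry (ltnW yM)) // !upd_at; congr (if _ then _ else _).
by rewrite (ev_cell (y := y)) // ?ms1 ?patch_addr // ltnW.
Qed.

Lemma winners_progP q s : ctx s -> reg s r_q = q -> env (memory s) ->
  memory (run winners_prog s) =1
    patch (memory s) tB (fun y => won_by I eta q (deg n y) (vset n y)) M.
Proof.
move=> cs rq [_ dE]; apply: each_cellP => // y s1 yM ry cs1 fr1 ms1 z.
set s2 := run (Qry r_acc (Reg r_y)) s1.
have cs2 : ctx s2 by exact: ctx_run.
rewrite [run _ s1](_ : _ = run (write tB (cell tD (Reg r_y) * (Reg r_acc == Reg r_q))%X) s2) //.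
rewrite (run_write _ cs2 (y := y)) //; last exact: ltnW.
rewrite [memory s2]/= !upd_at; congr (if _ then _ else _).
have Eq : eval w s2 (Reg r_acc == Reg r_q)%X = (eta (vset n y) == q :> nat).
  by apply: ev_eq; rewrite /= /upd /= ?ry // fr1.
have Ed : eval w s2 (cell tD (Reg r_y)) = dist_tab y.
  rewrite (ev_cell (y := y)) //; last exact: ltnW.
  by rewrite [memory s2]/= ms1 patch_addr // dE.
rewrite (ev_guard Ed (fun=> Eq)).
  by rewrite mulnb /won_by /dist_tab andbAC -andbA.
by have lt := M_lt; case: (dist_tab y); case: (_ == _) => /=; lia.
Qed.

Lemma clip_progP q s (F C : nat -> nat) : ctx s -> reg s r_q = q ->
    (forall y, y < M -> memory s (addr tT y) = F y) ->
    (forall y, y < M -> memory s (addr tC y) = C y) ->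
    (forall y, y < M -> F y <= 1) -> (forall y, y < M -> C y <= G * (N * N)) ->
  memory (run clip_prog s) =1 patch (memory s) tT (fun y => 0 < F y * (q != p) + C y) M.
Proof.
move=> cs rq FE CE F1 CG; have lt := M_lt; have [_ _ NM _ MG] := sizes; have N0 := N_gt0.
apply: each_cellP => // y s1 yM ry cs1 fr1 ms1 z.
rewrite (run_write _ cs1 _ ry (ltnW yM)) // !upd_at; congr (if _ then _ else _).
have rq1 : reg s1 r_q = q by rewrite fr1.
have rp : reg s1 r_p = p by case: cs1 => -[].
have Fy := F1 y yM; have Cy := CG y yM.
have b1 (b : bool) : F y * b <= 1 by case: b; lia.
have GN : 0 < G * (N * N) by lia.
have Ek : eval w s1 ((Reg r_q == Reg r_p) == 0)%X = (q != p).
  rewrite (ev_eq (ev_eq (ev_reg w rq1) (ev_reg w rp)) (ev_const (x := 0) _ _)); last by lia.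
  by case: (q == p).
have bb := b1 (q != p); apply: ev_lt; first by apply: ev_const; lia.
apply: ev_add; last by lia.
  apply: ev_mul; [|exact: Ek|by lia].
  by rewrite (ev_cell (y := y)) ?ms1 ?patch_addr ?ltnn ?FE // ltnW.
by rewrite (ev_cell (y := y)) ?ms1 ?patch_addr ?CE // ltnW.
Qed.

Lemma slot_progP q sl s : ctx s -> reg s r_q = q -> env (memory s) ->
    table_of sl (memory s) ->
  env (memory (run slot_prog s)) /\ table_of ((q, q != p) :: sl) (memory (run slot_prog s)).
Proof.
move=> cs0 q0 e0 F0; have lt := M_lt; have [nN _ NM _ MG] := sizes.
pose F g U : nat := coverable I eta sl g U; pose B g U : nat := won_by I eta q g U.
pose tab (f : nat -> {set 'I_n} -> nat) y := f (deg n y) (vset n y).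
rewrite (_ : run slot_prog s = run clip_prog (run (mobius_prog tC) (run product_prog
  (run (zeta_prog tB) (run winners_prog (run (zeta_prog tA) (run copy_prog s))))))) //.
set s1 := run copy_prog s; have cs1 : ctx s1 by exact: ctx_run.
have m1 : memory s1 =1 _ := copy_progP cs0.
have e1 : env (memory s1) by apply: (eq_env m1); exact: env_patch.
have q1 : reg s1 r_q = q by rewrite run_frame.
have A1 y : y < M -> memory s1 (addr tA y) = tab F y.
  by move=> yM; rewrite m1 patch_addr // eqxx yM F0.
set s2 := run (zeta_prog tA) s1; have cs2 : ctx s2 by exact: ctx_run.
have A1_le y : y < M -> memory s1 (addr tA y) <= 1 by move=> yM; rewrite A1 // leq_b1.
have m2 : memory s2 =1 _ := zeta_progP (a := tA) isT cs1 e1.1 A1_le.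
have e2 : env (memory s2) by apply: (eq_env m2); exact: env_patch.
have q2 : reg s2 r_q = q by rewrite run_frame.
have A2 y : y < M -> memory s2 (addr tA y) = zeta n (F (deg n y)) (vset n y).
  move=> yM; rewrite m2 patch_addr // eqxx yM (zeta_tab_eq _ yM A1).
  by apply: eq_bigr => W _; rewrite /tab deg_idx vset_idx.
set s3 := run winners_prog s2; have cs3 : ctx s3 by exact: ctx_run.
have m3 : memory s3 =1 _ := winners_progP cs2 q2 e2.
have e3 : env (memory s3) by apply: (eq_env m3); exact: env_patch.
have B3 y : y < M -> memory s3 (addr tB y) = tab B y.
  by move=> yM; rewrite m3 patch_addr // eqxx yM.
set s4 := run (zeta_prog tB) s3; have cs4 : ctx s4 by exact: ctx_run.
have B3_le y : y < M -> memory s3 (addr tB y) <= 1 by move=> yM; rewrite B3 // leq_b1.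
have m4 : memory s4 =1 _ := zeta_progP (a := tB) isT cs3 e3.1 B3_le.
have e4 : env (memory s4) by apply: (eq_env m4); exact: env_patch.
have A4 y : y < M -> memory s4 (addr tA y) = zeta n (F (deg n y)) (vset n y).
  by move=> yM; rewrite m4 patch_addr //= m3 patch_addr //= A2.
have B4 y : y < M -> memory s4 (addr tB y) = zeta n (B (deg n y)) (vset n y).
  move=> yM; rewrite m4 patch_addr // eqxx yM (zeta_tab_eq _ yM B3).
  by apply: eq_bigr => W _; rewrite /tab deg_idx vset_idx.
have zN (f : {set 'I_n} -> bool) U : zeta n (fun W => nat_of_bool (f W)) U <= N.
  by rewrite -[N]muln1; apply: zeta_le => W; exact: leq_b1.
set s5 := run product_prog s4; have cs5 : ctx s5 by exact: ctx_run.
have A4_le y : y < M -> memory s4 (addr tA y) <= N by move=> yM; rewrite A4 //; exact: zN.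
have B4_le y : y < M -> memory s4 (addr tB y) <= N by move=> yM; rewrite B4 //; exact: zN.
have m5 : memory s5 =1 _ := product_progP cs4 A4_le B4_le.
have e5 : env (memory s5) by apply: (eq_env m5); exact: env_patch.
pose C y := cover_prod F B (deg n y) (vset n y).
have CE y : y < M -> zeta_tab n C y =
    \sum_(h < (deg n y).+1) zeta n (F (deg n y - h)) (vset n y) * zeta n (B h) (vset n y).
  move=> yM; rewrite -zeta_cover_prod; apply: eq_bigr => W _.
  by rewrite /C deg_idx vset_idx.
have C_le y : y < M -> zeta_tab n C y <= G * (N * N).
  move=> yM; rewrite CE //; apply: leq_trans (_ : \sum_(h < (deg n y).+1) N * N <= _).
    by apply: leq_sum => h _; apply: leq_mul; exact: zN.
  by rewrite sum_nat_const card_ord leq_mul2r deg_lt yM orbT.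
have C5 y : y < M -> memory s5 (addr tC y) = zeta_tab n C y.
  move=> yM; rewrite m5 patch_addr // eqxx yM CE //; apply: eq_bigr => h _.
  have dG : deg n y < G by rewrite deg_lt.
  have hd := ltn_ord h; rewrite A4 ?B4 ?deg_idx ?vset_idx // idx_lt; lia.
set s6 := run (mobius_prog tC) s5; have cs6 : ctx s6 by exact: ctx_run.
have C_lt y : y < M -> zeta_tab n C y < 2 ^ w.
  by move=> yM; apply: leq_ltn_trans (C_le y yM) _; lia.
have m6 : memory s6 =1 _ := mobius_progP (a := tC) isT cs5 e5.1 C5 C_lt.
have e6 : env (memory s6) by apply: (eq_env m6); exact: env_patch.
have q6 : reg s6 r_q = q by rewrite 4?run_frame.
have T6 y : y < M -> memory s6 (addr tT y) = tab F y.
  move=> yM; rewrite m6 patch_addr //= m5 patch_addr //= m4 patch_addr //= m3 patch_addr //=.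
  by rewrite m2 patch_addr //= m1 patch_addr //= F0.
have C6 y : y < M -> memory s6 (addr tC y) = C y.
  by move=> yM; rewrite m6 patch_addr // eqxx yM.
have C6_le y : y < M -> C y <= G * (N * N).
  by move=> yM; apply: leq_trans (C_le y yM); rewrite -{1}[C y]zeta_tab0; exact: zeta_le_full.
have T6_le y : y < M -> tab F y <= 1 by move=> _; exact: leq_b1.
have m7 : memory (run clip_prog s6) =1 _ := clip_progP cs6 q6 T6 C6 T6_le C6_le.
split; first by apply: (eq_env m7); exact: env_patch.
move=> y yM; rewrite m7 patch_addr // eqxx yM addn_gt0 muln_gt0 !lt0b cover_prod_gt0 /=.
by rewrite [in RHS]andbC.
Qed.

Lemma exists_ltS (P : pred 'I_n) i (lt_in : i < n) :
  [exists v : 'I_n, (v < i.+1) && P v] = [exists v : 'I_n, (v < i) && P v] || P (Ordinal lt_in).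
Proof.
apply/existsP/orP => [[v /andP[]]|[/existsP[v /andP[vi Pv]]|Pi]].
- rewrite ltnS leq_eqVlt => /orP[/eqP vi|vi] Pv.
    by right; rewrite (_ : Ordinal _ = v) //; exact: val_inj.
  by left; apply/existsP; exists v; rewrite vi.
- by exists v; rewrite ltnS ltnW.
- by exists (Ordinal lt_in); rewrite ltnSn.
Qed.

Lemma exists_lt0 (P : pred 'I_n) : [exists v : 'I_n, (v < 0) && P v] = false.
Proof. by apply/existsP => -[]. Qed.

Lemma exists_lt_max (P : pred 'I_n) : [exists v : 'I_n, (v < n) && P v] = [exists v, P v].
Proof. by apply: eq_existsb => v; rewrite ltn_ord. Qed.

(* Removing [v] decreases the degree of a district by [n + 1]. *)
Definition shift (v : 'I_n) := n.+1 * N + 2 ^ v.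

Definition grows y (v u : 'I_n) : bool :=
  (v \in vset n y) && ((y == (n + 2) * N + 2 ^ v) ||
    [&& shift v <= y, dist_tab (y - shift v), u \in vset n y & adj I u v]).

Lemma dist_tab_grow y : dist_tab y = [exists v, exists u, grows y v u].
Proof.
rewrite /dist_tab district_grow; apply/andP/existsP => [[/exists_inP[v vU] E /eqP dE]|].
  have sh : shift v + idx (deg n y - n.+1) (vset n y :\ v) = y.
    have gn : n < deg n y by rewrite dE /wt (cardsD1 v) vU mulnDr muln1 addSn ltnS; lia.
    have gN : n.+1 * N <= deg n y * N by rewrite leq_mul2r gn orbT.
    rewrite -[RHS](idxE n) /shift /idx (word_D1 vU) -/N mulnBl.
    by move: (deg n y * N) (n.+1 * N) (2 ^ v) (word _) gN => a b c d; lia.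
  exists v; case/orP: E => [/eqP vE|/andP[dU /exists_inP[u uU uv]]]; apply/existsP.
    exists v; rewrite /grows vU /=; apply/orP; left; apply/eqP.
    rewrite -[LHS](idxE n) dE vE /idx /wt cards1 muln1 -addn1 addSn /word big_set1.
    by rewrite -/N; lia.
  exists u; rewrite /grows vU uU uv /= andbT; apply/orP; right; rewrite -sh leq_addr addKn.
  rewrite /dist_tab vset_idx deg_idx dU /= dE /wt (cardsD1 v) vU; apply/eqP; lia.
case=> v /existsP[u /andP[vU /orP[/eqP yE|/and4P[sh]]]].
  have [E1 E2] : deg n y = n + 2 /\ vset n y = [set v].
    have -> : y = idx (n + 2) [set v] by rewrite yE /idx /word big_set1.
    by rewrite deg_idx vset_idx.
  rewrite E1 E2 /wt cards1; split; last by apply/eqP; lia.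
  by apply/exists_inP; exists v; rewrite ?set11 ?eqxx.
have [gn E] : n < deg n y /\ y - shift v = idx (deg n y - n.+1) (vset n y :\ v).
  have wD := word_D1 vU; have wE := idxE n y; rewrite /idx wD -/N in wE.
  have gn : n < deg n y.
    rewrite ltnNge; apply/negP => dn; have wN : word (vset n y :\ v) < N := word_lt _.
    have dN : deg n y * N <= n * N by rewrite leq_mul2r dn orbT.
    move: sh wN; rewrite /shift -[X in _ <= X]wE mulSn.
    by move: (deg n y * N) (n * N) (2 ^ v) (word _) dN => a b c d; lia.
  split=> //; rewrite /shift /idx mulnBl -/N.
  have : n.+1 * N <= deg n y * N by rewrite leq_mul2r gn orbT.
  by move: (deg n y * N) (n.+1 * N) (2 ^ v) (word _) wE => a b c d; lia.
rewrite E /dist_tab vset_idx deg_idx => /andP[dD /eqP dE] uU uv; split.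
  by apply/exists_inP; exists v => //; rewrite dD; apply/orP; right; apply/exists_inP; exists u.
apply/eqP; move: dE; rewrite /wt (cardsD1 v (vset n y)) vU mulnDr muln1.
by move: (_ * #|_|) => c; lia.
Qed.

Definition adj_at mu := forall u v : 'I_n, mu (4 + (u * n + v)) = adj I u v.

Lemma adj_lt (u v : 'I_n) : 4 + (u * n + v) < L.
Proof. by have := ltn_ord u; have := ltn_ord v; rewrite /L; nia. Qed.

Lemma ev_shift s c d y (v : 'I_n) : ctx s -> menv (memory s) -> reg s r_i = v ->
    c <= 2 -> n + c = d ->
  eval w s ((Reg r_n + c) * Reg r_N + cell tP (Reg r_i))%X = d * N + 2 ^ v.
Proof.
move=> cs me ri c2 dE.
have lt := M_lt; have [nN G0 NM nG MG] := sizes; have N0 := N_gt0.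
have rn : reg s r_n = n by case: cs => -[].
have rN : reg s r_N = N by case: cs => _ [].
have pN : 2 ^ v <= N by rewrite leq_exp2l // ltnW.
have nM : d * N <= 2 * M.
  by rewrite /M mulnA leq_mul2r; apply/orP; right; rewrite /G; nia.
apply: ev_add; [|exact: ev_pow (ev_reg w ri)|by lia].
apply: ev_mul => //; [|lia]; rewrite -dE.
by apply: ev_add => //; [apply: ev_const|]; lia.
Qed.

Lemma set_flag r e s (b c : bool) : 1 < 2 ^ w -> eval w s e = c -> reg s r = b ->
  reg (run (Cnd e (Asg r 1)) s) r = b || c.
Proof.
move=> w1 Ee rb; rewrite run_Cnd Ee.
by case: c {Ee}; rewrite /= ?orbT ?orbF // /upd eqxx modn_small.
Qed.

Lemma memory_set_flag r e s : memory (run (Cnd e (Asg r 1)) s) = memory s.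
Proof. by rewrite run_Cnd; case: ifP. Qed.

Lemma district_testP y (v u : 'I_n) s (b : bool) :
    ctx s -> menv (memory s) -> adj_at (memory s) ->
    y < M -> (forall z, z < y -> memory s (addr tD z) = dist_tab z) ->
    reg s r_y = y -> reg s r_i = v -> reg s r_h = u -> reg s r_acc = b ->
  memory (run district_test s) = memory s /\
  reg (run district_test s) r_acc = b || grows y v u.
Proof.
move=> cs me ad yM dE ry ri rh ra; have lt := M_lt; have N0 := N_gt0.
have Eb := ev_bit cs me (ev_reg w ry) (ev_reg w ri).
rewrite /district_test run_Cnd Eb /grows; case vy: (v \in _); last by rewrite orbF.
set c1 := Cnd _ (Asg _ _); set c2 := Cnd _ (Cnd _ _); set s1 := run c1 s.
rewrite [if _ then _ else _](_ : _ = run c2 s1) // /c2.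
have cs1 : ctx s1 by exact: ctx_run.
have ms1 : memory s1 = memory s by exact: memory_set_flag.
have ra1 : reg s1 r_acc = b || (y == (n + 2) * N + 2 ^ v).
  apply: set_flag => //; first by lia.
  by apply: ev_eq => //; exact: ev_shift.
have [ry1 ri1 rh1] : [/\ reg s1 r_y = y, reg s1 r_i = v & reg s1 r_h = u].
  by split; rewrite run_frame.
have Es : eval w s1 ((Reg r_n + 1) * Reg r_N + cell tP (Reg r_i))%X = shift v.
  by apply: ev_shift; rewrite ?ms1 ?addn1.
have Eg : eval w s1 ((Reg r_y < (Reg r_n + 1) * Reg r_N + cell tP (Reg r_i)) == 0)%X
    = (shift v <= y).
  rewrite (ev_eq (ev_lt (ev_reg w ry1) Es) (ev_const (x := 0) _ _)); last by lia.
  by case: ltnP.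
rewrite run_Cnd Eg andTb; case: (leqP (shift v) y) => [sy|_]; last by rewrite orbF /= ms1.
set c3 := Cnd _ (Asg _ _); rewrite [if _ then _ else _](_ : _ = run c3 s1) // /c3 andTb.
rewrite memory_set_flag ms1 orbA; split=> //; apply: set_flag => //; first by lia.
have sh_gt0 : 0 < shift v by rewrite addn_gt0 muln_gt0 N0.
have Ed : eval w s1 (cell tD (Reg r_y - ((Reg r_n + 1) * Reg r_N + cell tP (Reg r_i))))
    = dist_tab (y - shift v).
  rewrite (ev_cell (y := y - shift v)) //; first by rewrite ms1 dE //; lia.
    by apply: ev_sub => //; lia.
  by lia.
have Ea : eval w s1 (Fetch (4 + (Reg r_h * Reg r_n + Reg r_i)))%X = adj I u v.
  suff Ex : eval w s1 (4 + (Reg r_h * Reg r_n + Reg r_i))%X = 4 + (u * n + v).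
    by rewrite -ad -ms1 -Ex.
  have uvL := adj_lt u v; have rn1 : reg s1 r_n = n by case: cs1 => -[].
  apply: ev_add; [apply: ev_const; lia| |lia].
  by apply: ev_add => //; [apply: ev_mul => //|]; lia.
have Eu : eval w s1 (bit (Reg r_y) (Reg r_h)) = (u \in vset n y).
  by apply: ev_bit => //; rewrite ms1.
have lt1 (b1 b2 : bool) : b1 * b2 < 2 ^ w by case: b1; case: b2; lia.
have Eua : eval w s1 (bit (Reg r_y) (Reg r_h) * Fetch (4 + (Reg r_h * Reg r_n + Reg r_i)))%X
    = ((u \in vset n y) && adj I u v).
  by rewrite -mulnb; exact: (ev_guard Eu (fun=> Ea)).
by rewrite -mulnb; exact: (ev_guard Ed (fun=> Eua)).
Qed.

Lemma districts_progP s : ctx s -> menv (memory s) -> adj_at (memory s) ->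
  memory (run districts_prog s) =1 patch (memory s) tD (fun y => dist_tab y) M.
Proof.
move=> cs me ad; have lt := M_lt; have [nN _ NM _ _] := sizes.
apply: each_cellP => // y s1 yM ry cs1 fr1 ms1 x.
have me1 : menv (memory s1) by apply: (eq_menv ms1); exact: menv_patch.
have ad1 : adj_at (memory s1) by move=> u v; rewrite ms1 patch_below ?adj_lt.
have d1 z : z < y -> memory s1 (addr tD z) = dist_tab z.
  by move=> zy; rewrite ms1 patch_addr // eqxx zy.
set c := For r_i r_n _; set s2 := run (Asg r_acc 0) s1.
have cs2 : ctx s2 by exact: ctx_run.
have rn2 : reg s2 r_n = n by case: cs2 => -[].
have [m3 a3] : memory (run c s2) = memory s1 /\ reg (run c s2) r_acc =
    [exists v : 'I_n, (v < reg s2 r_n) && [exists u, grows y v u]].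
  refine (run_for (Inv := fun i s' => memory s' = memory s1 /\
    reg s' r_acc = [exists v : 'I_n, (v < i) && [exists u, grows y v u]]) (b := r_n) _ _ _ _) => //.
  - by rewrite rn2; lia.
  - by split=> //; rewrite exists_lt0 /s2 /= /upd /= mod0n.
  move=> i s3 + ri fr3 [m3 a3]; rewrite rn2 => lt_in.
  have cs3 : ctx s3 by apply: (for_ctx (b := r_n)) fr3.
  have rn3 : reg s3 r_n = n by case: cs3 => -[].
  have ry3 : reg s3 r_y = y by rewrite fr3 // /s2 /= /upd.
  pose v := Ordinal lt_in.
  have -> : [exists v : 'I_n, (v < i.+1) && [exists u, grows y v u]] =
      [exists v : 'I_n, (v < i) && [exists u, grows y v u]] ||
      [exists u : 'I_n, (u < reg s3 r_n) && grows y v u].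
    by rewrite (exists_ltS (fun v => [exists u, grows y v u]) lt_in) rn3 exists_lt_max.
  refine (run_for (Inv := fun j s' => memory s' = memory s1 /\ reg s' r_acc =
    [exists v : 'I_n, (v < i) && [exists u, grows y v u]] ||
    [exists u : 'I_n, (u < j) && grows y v u]) (b := r_n) _ _ _ _) => //.
  - by rewrite rn3; lia.
  - by split=> //; rewrite exists_lt0 orbF.
  move=> j s4 + rj fr4 [m4 a4]; rewrite rn3 => lt_jn.
  have cs4 : ctx s4 by apply: (for_ctx (b := r_n)) fr4.
  have [] := @district_testP y v (Ordinal lt_jn) s4 _ cs4 _ _ yM _ _ _ rj a4.
  - by rewrite m4.
  - by rewrite m4.
  - by rewrite m4.
  - by rewrite fr4.
  - by rewrite fr4.
  by move=> m5 a5; rewrite (exists_ltS (grows y v) lt_jn) orbA -m4 -m5 -a5.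
have cs4 : ctx (run c s2) by exact: ctx_run.
rewrite [run _ s1](_ : _ = run (write tD (Reg r_acc)) (run c s2)) //.
rewrite (run_write _ cs4 (y := y)) //; last exact: ltnW.
  by rewrite m3 !upd_at [eval _ _ _]/= a3 rn2 exists_lt_max -dist_tab_grow.
by rewrite run_frame // /s2 /= /upd.
Qed.

Lemma init_tableP s : ctx s ->
  memory (run (each_cell (write tT (Reg r_y == 0)%X)) s) =1
    patch (memory s) tT (fun y => coverable I eta [::] (deg n y) (vset n y)) M.
Proof.
move=> cs; have lt := M_lt; apply: each_cellP => // y s1 yM ry cs1 _ ms1 z.
rewrite (run_write _ cs1 _ ry (ltnW yM)) // !upd_at; congr (if _ then _ else _).
rewrite (ev_eq (ev_reg w ry) (ev_const (x := 0) _ _)); last by lia.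
by rewrite /= -(idx_inj (deg n y)) idxE /idx word0 mul0n.
Qed.

Lemma slots_progP q t sl s : ctx s -> reg s r_q = q -> reg s r_t = t -> t < n ->
    env (memory s) -> table_of sl (memory s) ->
  let s' := run (For r_s r_n
       (Cnd (Reg r_s < Reg r_t + (Reg r_q == Reg r_p))%X slot_prog)) s in
  env (memory s') /\
  table_of (nseq (t + (q == p)) (q, q != p) ++ sl) (memory s').
Proof.
move=> cs rq rt tn e0 T0 s'.
have rn : reg s r_n = n by case: cs => -[].
have lt := M_lt; have [nN _ NM _ _] := sizes.
have -> : t + (q == p) = minn (reg s r_n) (t + (q == p)).
  by rewrite rn; apply/esym/minn_idPr; case: (q == p); lia.
rewrite {}/s'.
refine (run_for (Inv := fun j s' => env (memory s') /\
  table_of (nseq (minn j (t + (q == p))) (q, q != p) ++ sl) (memory s'))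
  (b := r_n) _ _ _ _) => //.
- by rewrite rn; lia.
- by rewrite min0n.
move=> j s1 + rj fr [e1 T1]; rewrite rn => jn.
have cs1 : ctx s1 by apply: (for_ctx (b := r_n)) fr.
have rq1 : reg s1 r_q = q by rewrite fr.
have rt1 : reg s1 r_t = t by rewrite fr.
have rp1 : reg s1 r_p = p by case: cs1 => -[].
have Ec : eval w s1 (Reg r_s < Reg r_t + (Reg r_q == Reg r_p))%X = (j < t + (q == p)).
  apply: ev_lt => //; apply: ev_add => //; first exact: ev_eq.
  by case: (q == p); lia.
rewrite run_Cnd Ec; case: (ltnP j (t + (q == p))) => jt.
  rewrite (_ : minn j.+1 _ = (minn j (t + (q == p))).+1); last by lia.
  exact: slot_progP.
by rewrite (_ : minn j.+1 _ = minn j (t + (q == p))); last by lia.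
Qed.

Definition solved t := (k <= n) && coverable I eta (slots p t m) (n * n.+1 + k) setT.

Lemma main_progP s : ctx s -> env (memory s) -> reg s r_ans = 0 ->
  reg (run main_prog s) r_ans = wgm_yes I eta.
Proof.
move=> cs e0 a0; have lt := M_lt; have [nN _ NM nG MG] := sizes; have N0 := N_gt0.
have rn : reg s r_n = n by case: cs => -[].
have -> : wgm_yes I eta = has solved (iota 0 (reg s r_n)).
  rewrite wgm_yes_coverable rn /solved; case: (k <= n) => //=.
  by elim: (iota 0 n).
rewrite /main_prog.
suff [] : env (memory (run main_prog s)) /\
    reg (run main_prog s) r_ans = has solved (iota 0 (reg s r_n)) by [].
refine (run_for (Inv := fun t s' => env (memory s') /\ reg s' r_ans = has solved (iota 0 t))
  (b := r_n) _ _ _ _) => //.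
  by rewrite rn; lia.
move=> t s1 + rt fr [e1 a1]; rewrite rn => tn.
have cs1 : ctx s1 by apply: (for_ctx (b := r_n)) fr.
set c1 := each_cell _; set c2 := For r_q r_m _; set c3 := Cnd _ _.
rewrite (_ : run (c1 ;; c2 ;; c3) s1 = run c3 (run c2 (run c1 s1))) //.
set s2 := run c1 s1; have cs2 : ctx s2 by exact: ctx_run.
have m2 : memory s2 =1 _ := init_tableP cs1.
have e2 : env (memory s2) by apply: (eq_env m2); exact: env_patch.
have T2 : table_of [::] (memory s2) by move=> y yM; rewrite m2 patch_addr // eqxx yM.
have rm2 : reg s2 r_m = m by case: cs2 => -[].
have [e3 T3] : env (memory (run c2 s2)) /\
    table_of (slots p t (reg s2 r_m)) (memory (run c2 s2)).
  refine (run_for (Inv := fun q s' => env (memory s') /\ table_of (slots p t q) (memory s'))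
    (b := r_m) _ _ _ _) => //.
    by rewrite rm2.
  move=> q s3 qm rq fr3 [e3 T3].
  have cs3 : ctx s3 by apply: (for_ctx (b := r_m)) fr3.
  by apply: slots_progP => //; rewrite fr3 // run_frame.
rewrite rm2 in T3.
set s4 := run c2 s2 in e3 T3 *; have cs4 : ctx s4 by exact: ctx_run.
have a4 : reg s4 r_ans = has solved (iota 0 t) by rewrite !run_frame.
have -> : has solved (iota 0 t.+1) = has solved (iota 0 t) || solved t.
  by rewrite -addn1 iotaD has_cat /= orbF.
have rn4 : reg s4 r_n = n by case: cs4 => -[].
have rN4 : reg s4 r_N = N by case: cs4 => _ [].
have rk4 : reg s4 r_k = k by case: cs4 => _ [].
have En1 : eval w s4 (Reg r_n + 1)%X = n.+1.
  by rewrite -[n.+1]addn1; apply: ev_add => //; [apply: ev_const|]; lia.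
have Ek : eval w s4 (Reg r_k < Reg r_n + 1)%X = (k <= n).
  by rewrite -[k <= n]ltnS; exact: ev_lt.
rewrite /c3 run_Cnd Ek [solved t]/solved; case: (leqP k n) => kn; last first.
  by rewrite andFb orbF; split; [exact: e3|exact: a4].
have dG : n * n.+1 + k < G by rewrite /G; lia.
have iM : idx (n * n.+1 + k) [set: 'I_n] < M by rewrite idx_lt.
have iE : idx (n * n.+1 + k) [set: 'I_n] = (n * n.+1 + k) * N + (N - 1).
  by rewrite /idx wordT subn1.
have Ec : eval w s4 (cell tT ((Reg r_n * (Reg r_n + 1) + Reg r_k) * Reg r_N + (Reg r_N - 1)))
    = coverable I eta (slots p t m) (n * n.+1 + k) [set: 'I_n].
  have dM : (n * n.+1 + k) * N <= M by rewrite leq_mul2r ltnW ?orbT.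
  have dlt : n * n.+1 + k < 2 ^ w.
    by apply: leq_ltn_trans (_ : M < _); last lia; apply: leq_trans dM; rewrite leq_pmulr.
  rewrite (ev_cell (y := idx (n * n.+1 + k) [set: 'I_n])) //; last exact: ltnW.
    by rewrite T3 // deg_idx vset_idx.
  rewrite iE; apply: ev_add; last by rewrite -iE; lia.
    apply: ev_mul => //; last by lia.
    by apply: ev_add => //; apply: ev_mul => //; lia.
  by apply: ev_sub => //; [apply: ev_const; lia|lia].
set c4 := Cnd _ _; rewrite [if _ then _ else _](_ : _ = run c4 s4) //.
split; first by rewrite [memory _](memory_set_flag _ _ s4).
by apply: set_flag => //; lia.
Qed.

Let s0 := init_state I.
Let s1 := run header_prog s0.
Let s2 := run powers_prog s1.
Let s3 := run sizes_prog s2.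

Lemma header_regs : [/\ reg s1 r_n = n, reg s1 r_m = m & reg s1 r_p = p] /\
  [/\ reg s1 r_k = k, reg s1 r_N = 1, reg s1 r_L = L & memory s1 = memory s0].
Proof.
have lt := M_lt; have small x : x <= 8 -> x %% 2 ^ w = x by move=> x8; rewrite modn_small; lia.
have nL : 4 + n * n = L by [].
rewrite /s1 /= /upd /= (small 0) // (small 1) // (small 2) // (small 3) // (small 4) //=.
by split; split=> //; rewrite !modn_small //; lia.
Qed.

Lemma powers_progP : [/\ reg s2 r_N = N, menv (memory s2) &
  forall x, x < L -> memory s2 x = memory s0 x].
Proof.
have [[rn _ _] [_ rN rL ms1]] := header_regs.
have lt := M_lt; have [nN _ NM _ _] := sizes.
suff [] : [/\ reg s2 r_N = 2 ^ reg s1 r_n,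
    forall v, v < reg s1 r_n -> memory s2 (addr tP v) = 2 ^ v &
    forall x, x < L -> memory s2 x = memory s1 x] by rewrite rn ms1.
refine (run_for (Inv := fun i s' => [/\ reg s' r_N = 2 ^ i,
    forall v, v < i -> memory s' (addr tP v) = 2 ^ v &
    forall x, x < L -> memory s' x = memory s1 x]) (b := r_n) _ _ _ _) => //.
  by rewrite rn; lia.
move=> i s + ri fr [rN_i Pi mi]; rewrite rn => lt_in.
have rLs : reg s r_L = L by rewrite fr.
have pN : 2 ^ i.+1 <= N by rewrite leq_exp2l.
have w8 : 8 < 2 ^ w by lia.
have E : eval w s (cell_at tP (Reg r_i)) = addr tP i.
  by apply: ev_cell_at => //; lia.
set c := Sq _ _; have mE : memory (run c s) = upd (memory s) (addr tP i) (2 ^ i).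
  by rewrite -E -rN_i.
split=> [|v vi|x xL].
- have E2 : 2 %% 2 ^ w = 2 by rewrite modn_small; lia.
  by rewrite /= /upd /= rN_i E2 -expnSr modn_small; lia.
- rewrite [LHS](_ : _ = memory (run c s) (addr tP v)) // mE upd_at; case: eqP => [eq|ne].
    by congr (2 ^ _); move: eq; rewrite /addr; lia.
  by apply: Pi; have : v <> i by [move=> vE; case: ne; rewrite vE]; lia.
- rewrite [LHS](_ : _ = memory (run c s) x) // mE.
  by rewrite upd_at mi // ltn_eqF // /addr; lia.
Qed.

Lemma nth_flatten_const (T : Type) (x0 : T) (A : eqType) (r : A -> seq T) l d i j :
  (forall a, size (r a) = d) -> j < d ->
  nth x0 (flatten (map r l)) (i * d + j) = nth x0 (nth [::] (map r l) i) j.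
Proof.
move=> rd jd; elim: l i => [|a l IH] i; first by rewrite /= !nth_nil.
rewrite /= nth_cat rd; case: i => [|i]; first by rewrite mul0n add0n jd.
by rewrite mulSn -addnA ltnNge leq_addr /= addKn IH.
Qed.

Lemma adj_at_init : adj_at (memory s0).
Proof.
move=> u v; rewrite -[LHS]/(nth 0 (input_words I) (4 + (u * n + v))) /input_words /= nth_cat.
set r := fun u : 'I_n => [seq nat_of_bool (adj I u v) | v <- enum 'I_n].
have rd a : size (r a) = n by rewrite size_map size_enum_ord.
have sz : size (flatten (map r (enum 'I_n))) = n * n.
  by rewrite -[LHS]/(size [seq nat_of_bool (adj I u v) | u <- enum 'I_n, v <- enum 'I_n])
    size_allpairs size_enum_ord.
have un := ltn_ord u; have vn := ltn_ord v.
rewrite sz (_ : u * n + v < n * n); last by nia.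
rewrite nth_flatten_const // (nth_map u) ?size_enum_ord // (nth_map u) ?size_enum_ord //.
by rewrite !nth_ord_enum.
Qed.

Lemma init_done : [/\ ctx s3, menv (memory s3) & adj_at (memory s3)].
Proof.
have [[rn rm rp] [rk _ rL _]] := header_regs; have [rN me m0] := powers_progP.
have frame x : x \notin mods powers_prog -> reg s2 x = reg s1 x by exact: run_frame.
have lt := M_lt; have [_ _ NM nG MG] := sizes.
have GM : G <= M by rewrite /M leq_pmulr // N_gt0.
have En : eval w s2 (Reg r_n + 1)%X = n.+1.
  by rewrite -[n.+1]addn1; apply: ev_add; [rewrite /= frame|apply: ev_const; lia|lia].
set t := run (Asg r_G ((Reg r_n + 1) * (Reg r_n + 1))%X) s2.
have rG : reg t r_G = G by apply: (ev_mul En En); rewrite -/G; lia.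
have rM : reg s3 r_M = M.
  have tN : reg t r_N = N by rewrite run_frame.
  suff : eval w t (Reg r_G * Reg r_N)%X = M by [].
  by apply: ev_mul => //; rewrite -/M; lia.
split=> //; last by move=> u v; rewrite m0 ?adj_lt ?adj_at_init.
have fr x : x \notin mods (powers_prog ;; sizes_prog) -> reg s3 x = reg s1 x.
  by move=> nx; rewrite -(run_frame w (rule_oracle eta) s1 nx).
split; first by rewrite !fr.
have N3 : reg s3 r_N = N by rewrite run_frame.
have G3 : reg s3 r_G = G.
  by rewrite -rG /s3 [run _ _](_ : _ = run (Asg r_M (Reg r_G * Reg r_N)%X) t) // run_frame.
by split=> //; rewrite fr.
Qed.

Lemma run_correct : reg (run (districts_prog ;; main_prog) s3) r_ans = wgm_yes I eta.
Proof.
have [cs me ad] := init_done; have mD := districts_progP cs me ad.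
rewrite [run _ _](_ : _ = run main_prog (run districts_prog s3)) //.
apply: main_progP; first exact: ctx_run.
  split; first by apply: (eq_menv mD); exact: menv_patch.
  by move=> y yM; rewrite mD patch_addr // eqxx yM.
by rewrite run_frame // /s3 run_frame // /s2 run_frame // /s1 run_frame.
Qed.

(* Exponents of [n + m] and of [2 ^ n] in the number of rounds of a loop. *)
Definition loop_deg (b : nat) : nat * nat := nth (0, 0)
  [:: (0, 0); (1, 0); (1, 0); (0, 0); (0, 0); (0, 0); (2, 0); (2, 1)] b.

Definition gm_coef : nat :=
  coef header_prog + coef powers_prog + coef sizes_prog + coef (districts_prog ;; main_prog) + 32.

Definition gm_deg : nat := (dega loop_deg (districts_prog ;; main_prog)).1.

Lemma gm_exec : exists2 t, t <= gm_coef * (2 ^ n * (n + m) ^ gm_deg) &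
  exec w (rule_oracle eta) gm_prog s0 t (run (districts_prog ;; main_prog) s3).
Proof.
have m_gt0 : 0 < m := leq_ltn_trans (leq0n _) (ltn_ord (target I)).
have S0 : 0 < n + m by rewrite addn_gt0 m_gt0 orbT.
have nS : n < n + m by rewrite -addn1 leq_add2l.
have N0 := N_gt0; have lt := M_lt; have [_ _ NM nG MG] := sizes.
have GM : G <= M by rewrite /M leq_pmulr.
have GS : G <= (n + m) ^ 2 by rewrite expnS expn1 leq_mul.
have [[rn _ _] _] := header_regs; have [[[rn3 rm3 _] [_ _ rG3 rM3 _]] _ _] := init_done.
have ce bd c s : ok bd c -> bounded w (n + m) N loop_deg bd s ->
  exists2 t, exec w (rule_oracle eta) (compile c) s t (run c s) &
     t <= coef c * monom (n + m) N (dega loop_deg c).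
  by move=> okc bs; apply: compile_exec okc bs.
have [||t1 ex1 le1] := ce [::] header_prog s0; [by []|by []|].
have [||t2 ex2 le2] := ce [:: r_n] powers_prog s1; first by [].
  move=> b; rewrite inE => /eqP ->; rewrite rn; split; first by lia.
  by rewrite /monom /= expn0 muln1 expn1 ltnW.
have [||t3 ex3 le3] := ce [::] sizes_prog s2; [by []|by []|].
have [||t4 ex4 le4] := ce [:: r_n; r_m; r_G; r_M] (districts_prog ;; main_prog) s3; first by [].
  move=> b; rewrite !inE => /or4P[] /eqP ->; rewrite ?rn3 ?rm3 ?rG3 ?rM3 /monom /= ?expn0 ?expn1 ?muln1;
    split; try lia.
  by rewrite leq_mul2r GS orbT.
exists (t1 + (t2 + (t3 + t4))); last by do 3!(apply: ExecSeq; first by eauto).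
pose X := monom (n + m) N (gm_deg, 1).
have monX c : (dega loop_deg c).1 <= gm_deg -> (dega loop_deg c).2 <= 1 ->
    coef c * monom (n + m) N (dega loop_deg c) <= coef c * X.
  by move=> d1 d2; rewrite leq_mul2l monom_le ?orbT.
have -> : 2 ^ n * (n + m) ^ gm_deg = X by rewrite /X /monom expn1 mulnC.
have {}le1 := leq_trans le1 (monX header_prog isT isT).
have {}le2 := leq_trans le2 (monX powers_prog isT isT).
have {}le3 := leq_trans le3 (monX sizes_prog isT isT).
have {}le4 := leq_trans le4 (monX (districts_prog ;; main_prog) isT isT).
rewrite /gm_coef; move: le1 le2 le3 le4.
move: (coef header_prog) (coef powers_prog) (coef sizes_prog) (coef (_ ;; _)) => b1 b2 b3 b4.
by move=> le1 le2 le3 le4; rewrite !mulnDl; lia.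
Qed.

End Verification.

Theorem theorem4 :
  exists (prog : cmd) (a c : nat),
    forall (n m : nat) (I : wgm 'I_n 'I_m) (eta : {set 'I_n} -> 'I_m) (w : nat),
      tie_breaking I eta ->
      fits w I ->
      long_words w a c n m ->
      decides_within w prog I eta (a * (2 ^ n * (n + m) ^ c)).
Proof.
exists gm_prog, gm_coef, gm_deg => n m I eta w _ /allP fit long.
have m_lt : m < 2 ^ w by apply: fit; rewrite !inE eqxx orbT.
have k_lt : nb_districts I < 2 ^ w by apply: fit; rewrite !inE eqxx !orbT.
have m_gt0 : 0 < m := leq_ltn_trans (leq0n _) (ltn_ord (target I)).
have roomy : 32 * (n.+1 * n.+1 * (2 ^ n * 2 ^ n)) < 2 ^ w.
  apply: leq_trans long.
  have nS : n < n + m by rewrite -addn1 leq_add2l.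
  have X0 : 0 < 2 ^ n * (n + m) by rewrite muln_gt0 expn_gt0 (leq_ltn_trans _ nS).
  have sq : n.+1 * n.+1 * (2 ^ n * 2 ^ n) <= (2 ^ n * (n + m)) ^ gm_deg.
    apply: leq_trans (_ : (2 ^ n * (n + m)) ^ 2 <= _); last by rewrite leq_pexp2l.
    by rewrite expnS expn1 [_ * _ * _]mulnC mulnACA leq_mul // leq_mul2l nS orbT.
  have big : 32 < gm_coef by [].
  apply: leq_trans (_ : 33 * (2 ^ n * (n + m)) ^ gm_deg <= _); last by rewrite leq_mul2r big orbT.
  have : 0 < (2 ^ n * (n + m)) ^ gm_deg by rewrite expn_gt0 X0.
  by move: (_ ^ gm_deg) sq => Y; lia.
have [t le ex] := gm_exec eta roomy m_lt k_lt.
by exists t; eexists; split; [exact: ex|exact: le|exact: run_correct].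
Qed.
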